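(* Let $X$ be a real locally convex space and $\mu$ a probability measure on the Borel sets of $X$ such that every continuous linear functional on $X$ is $\mu$-integrable and has $\mu$-integral zero. Let $\mathcal{L}(\mu)$, the asymmetric norms $p,\bar p$ on $\mathcal{L}(\mu)$, the function $W_\mu:\mathcal{L}(\mu)\to\overline{\mathbb{R}}$, its convex conjugate $W_\mu^*:(\mathcal{L}(\mu),\bar p)^*\to\overline{\mathbb{R}}$ and the dual norm $\Vert\cdot\Vert_s^*$ be as defined in the context. Let $y\in\mathrm{dom}\,W_\mu^*$ be such that for some $\epsilon>0$, $$\sup\left\{W_\mu^*(y+z)\ \middle|\ z\in(\mathcal{L}(\mu),\bar p)^*:\ \Vert z\Vert_s^*<\epsilon\right\}<\infty.$$ Then there is a $T\in\mathcal{L}(\mu)$ at which the infimum of $W_\mu-y$ over $\mathcal{L}(\mu)$ is attained, and every minimising sequence $(T_n)_{n\in\mathbb{N}}$ of $W_\mu-y$ in $\mathcal{L}(\mu)$ converges $\bar p$-weakly to $T$.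
   Context: $\overline{\mathbb{R}}=\{-\infty\}\cup\mathbb{R}\cup\{\infty\}$; $\mathrm{dom}\,F=\{u:F(u)<\infty\}$; $\mathrm{epi}\,F=\{(u,t):t\in\mathbb{R},\,F(u)\le t\}$. Let $X^*$ be the space of continuous linear functionals on the locally convex space $X$ and $[\cdot]_\mu$ the equivalence class modulo $\mu$-almost everywhere equality. Put $\mathcal{K}(\mu)=\{[\phi]_\mu:\phi\in X^*\}$, and let $\mathcal{M}(\mu)$ be its completion in the topology of convergence in $\mu$-measure, i.e. its closure in the space $L^0(\mu)$ of classes of real measurable functions with that topology. The cumulant-generating function $V_\mu:\mathcal{K}(\mu)\to\overline{\mathbb{R}}$ is $V_\mu(T)=\ln\int_X\exp[T]\,\mathrm{d}\mu$. Let $\overline{W}_\mu:\mathcal{M}(\mu)\to\overline{\mathbb{R}}$ be the greatest lower semicontinuous function (for convergence in $\mu$-measure) whose restriction to $\mathcal{K}(\mu)$ is $\le V_\mu$; equivalently, $\mathrm{epi}\,\overline{W}_\mu$ is the closure of $\mathrm{epi}\,V_\mu$ in $\mathcal{M}(\mu)\times\mathbb{R}$. Put $\mathcal{L}(\mu)=\mathcal{M}(\mu)\cap L^1(\mu)$ and let $W_\mu$ be the restriction of $\overline{W}_\mu$ to $\mathcal{L}(\mu)$. Equip $\mathcal{L}(\mu)$ with the asymmetric norm $p(T)=\int_X\max\{-T,0\}\,\mathrm{d}\mu$, and put $\bar p(T)=p(-T)=\int_X\max\{T,0\}\,\mathrm{d}\mu$. The dual cone $(\mathcal{L}(\mu),\bar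 p)^*$ is the set of linear functionals $z:\mathcal{L}(\mu)\to\mathbb{R}$ for which there is $C\ge0$ with $z(T)\le C\,\bar p(T)$ for all $T\in\mathcal{L}(\mu)$. $\mathcal{L}(\mu)_s$ denotes $\mathcal{L}(\mu)$ with the norm $\max\{p,\bar p\}$, and $\Vert\cdot\Vert_s^*$ is the dual norm on the topological dual $(\mathcal{L}(\mu)_s)^*$, which contains $(\mathcal{L}(\mu),\bar p)^*$. The convex conjugate is $W_\mu^*(y)=\sup_{T\in\mathcal{L}(\mu)}[y(T)-W_\mu(T)]$ for $y\in(\mathcal{L}(\mu),\bar p)^*$. A minimising sequence of $W_\mu-y$ is a sequence $(T_n)$ in $\mathcal{L}(\mu)$ with $\lim_n(W_\mu(T_n)-y(T_n))=\inf_{\mathcal{L}(\mu)}(W_\mu-y)$. A sequence $(T_n)$ converges $\bar p$-weakly to $T$ if $\limsup_{n\to\infty}z(T_n-T)\le0$ for all $z\in(\mathcal{L}(\mu),\bar p)^*$. *)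

(* Defs.v *)
From HB Require Import structures.
From mathcomp Require Import all_boot all_order all_algebra.
From mathcomp Require Import all_classical all_reals all_analysis.
From mathcomp Require Import measurable_realfun.

Set Implicit Arguments.
Unset Strict Implicit.
Unset Printing Implicit Defensive.

Import Order.TTheory GRing.Theory Num.Theory numFieldNormedType.Exports.

Local Open Scope classical_set_scope.
Local Open Scope ring_scope.

(* The classes modulo mu-almost everywhere equality of real measurable        *)
(* functions. Its vector space structure and the topology of convergence in   *)
(* mu-measure are given by the instances below.                               *)
Definition L0 d (T : measurableType d) (R : realType) (mu : probability T R) :=
  {mfun_ mu, T >-> R}.

Section L0_lmodule.
Context d (T : measurableType d) (R : realType) (mu : probability T R).
Implicit Types (f g h : L0 mu) (a b : R).

HB.instance Definition _ := Choice.on (L0 mu).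

Definition L0_fun f : {mfun T >-> R} := repr f.
Coercion L0_fun : L0 >-> MeasurableFun.type.

Definition L0_class (f : T -> R) (mf : measurable_fun setT f) : L0 mu :=
  \pi_({mfun_ mu, T >-> R})%qT (mfun_Sub (mem_set mf)).

Lemma L0_eqP f g : (f = g) <-> {ae mu, forall x, f x = g x}.
Proof.
split=> [->|fg]; first exact: aeW.
have /ae_eqP/eqP : (f : T -> R) = g %[ae mu] by apply: filterS fg => x fgx _.
by rewrite !reprK.
Qed.

Lemma L0_classE (f : T -> R) (mf : measurable_fun setT f) :
  {ae mu, forall x, L0_class mf x = f x}.
Proof.
have : repr (L0_class mf) = mfun_Sub (mem_set mf)
  %[mod {mfun_ mu, T >-> R}]%qT by rewrite reprK.
move=> /eqP; rewrite eqmodE => /asboolP.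
by apply: filterS => x /(_ I).
Qed.

Lemma L0_measurable f : measurable_fun setT f.
Proof. exact: measurable_funPT. Qed.

Definition L0_zero : L0 mu := L0_class (measurable_cst (0 : R)).
Definition L0_add f g : L0 mu :=
  L0_class (measurable_funD (L0_measurable f) (L0_measurable g)).
Definition L0_opp f : L0 mu := L0_class (measurable_funN (L0_measurable f)).
Definition L0_scale a f : L0 mu :=
  L0_class (measurable_funM (measurable_cst a) (L0_measurable f)).

Let zeroE : {ae mu, forall x, L0_zero x = 0}.
Proof. exact: L0_classE. Qed.
Let addE f g : {ae mu, forall x, L0_add f g x = f x + g x}.
Proof. exact: L0_classE. Qed.
Let oppE f : {ae mu, forall x, L0_opp f x = - f x}.
Proof. exact: L0_classE. Qed.
Let scaleE a f : {ae mu, forall x, L0_scale a f x = a * f x}.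
Proof. exact: L0_classE. Qed.

Let addA : associative L0_add.
Proof.
move=> f g h; apply/L0_eqP; near=> x.
rewrite (near (addE f (L0_add g h)) x)// (near (addE g h) x)//.
by rewrite (near (addE (L0_add f g) h) x)// (near (addE f g) x)// addrA.
Unshelve. all: by end_near. Qed.

Let addC : commutative L0_add.
Proof.
move=> f g; apply/L0_eqP; near=> x.
by rewrite (near (addE f g) x)// (near (addE g f) x)// addrC.
Unshelve. all: by end_near. Qed.

Let add0 : left_id L0_zero L0_add.
Proof.
move=> f; apply/L0_eqP; near=> x.
by rewrite (near (addE L0_zero f) x)// (near zeroE x)// add0r.
Unshelve. all: by end_near. Qed.

Let addN : left_inverse L0_zero L0_opp L0_add.
Proof.
move=> f; apply/L0_eqP; near=> x.
rewrite (near (addE (L0_opp f) f) x)// (near (oppE f) x)//.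
by rewrite (near zeroE x)// addNr.
Unshelve. all: by end_near. Qed.

HB.instance Definition _ := GRing.isZmodule.Build (L0 mu) addA addC add0 addN.

Let scaleA a b f : L0_scale a (L0_scale b f) = L0_scale (a * b) f.
Proof.
apply/L0_eqP; near=> x.
rewrite (near (scaleE a (L0_scale b f)) x)// (near (scaleE b f) x)//.
by rewrite (near (scaleE (a * b) f) x)// mulrA.
Unshelve. all: by end_near. Qed.

Let scale1 : left_id 1 L0_scale.
Proof.
move=> f; apply/L0_eqP; near=> x.
by rewrite (near (scaleE 1 f) x)// mul1r.
Unshelve. all: by end_near. Qed.

Let scaleDr : right_distributive L0_scale +%R.
Proof.
move=> a f g; apply/L0_eqP; near=> x.
rewrite (near (scaleE a (f + g)) x)// (near (addE f g) x)//.
rewrite (near (addE (L0_scale a f) (L0_scale a g)) x)//.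
by rewrite (near (scaleE a f) x)// (near (scaleE a g) x)// mulrDr.
Unshelve. all: by end_near. Qed.

Let scaleDl f : {morph L0_scale^~ f : a b / a + b}.
Proof.
move=> a b; apply/L0_eqP; near=> x.
rewrite (near (scaleE (a + b) f) x)//.
rewrite (near (addE (L0_scale a f) (L0_scale b f)) x)//.
by rewrite (near (scaleE a f) x)// (near (scaleE b f) x)// mulrDl.
Unshelve. all: by end_near. Qed.

HB.instance Definition _ := GRing.Zmodule_isLmodule.Build R (L0 mu)
  scaleA scale1 scaleDr scaleDl.

Lemma L0_0E : {ae mu, forall x, (0 : L0 mu) x = 0}. Proof. exact: zeroE. Qed.

Lemma L0_DE f g : {ae mu, forall x, (f + g : L0 mu) x = f x + g x}.
Proof. exact: addE. Qed.

Lemma L0_NE f : {ae mu, forall x, (- f : L0 mu) x = - f x}. Proof. exact: oppE. Qed.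

Lemma L0_ZE a f : {ae mu, forall x, (a *: f : L0 mu) x = a * f x}.
Proof. exact: scaleE. Qed.

End L0_lmodule.

Section L0_topology.
Context d (T : measurableType d) (R : realType) (mu : probability T R).
Implicit Types (f g h : L0 mu) (e : R).

Definition L0_dev f g e : set T := [set x | e <= `|f x - g x|].

(* The balls of the Ky Fan metric. *)
Definition L0_ball f e : set (L0 mu) :=
  [set g | (mu (L0_dev f g e) < e%:E)%E].

Lemma L0_measurable_dist f g e : measurable (L0_dev f g e).
Proof.
have mfg : measurable_fun setT (fun x => `|f x - g x|).
  exact/measurableT_comp/measurable_funB/L0_measurable/L0_measurable.
rewrite (_ : L0_dev f g e = (fun x => `|f x - g x|) @^-1` `[e, +oo[).
  by rewrite -[X in measurable X]setTI; exact: mfg.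
by apply/seteqP; split => x /=; rewrite in_itv/= andbT.
Qed.

Let ball_gt0 f e g : L0_ball f e g -> 0 < e.
Proof. by rewrite -lte_fin; apply: le_lt_trans; exact: measure_ge0. Qed.

Let ball_center f e : 0 < e -> L0_ball f e f.
Proof.
move=> e0; rewrite /L0_ball/= (_ : L0_dev f f e = set0) ?measure0 ?lte_fin//.
by apply/seteqP; split => x //; rewrite /L0_dev/= subrr normr0 leNgt e0.
Qed.

Let ball_sym f g e : L0_ball f e g -> L0_ball g e f.
Proof.
rewrite /L0_ball/=; apply: le_lt_trans; apply: le_measure;
  rewrite ?inE; [exact: L0_measurable_dist..|].
by move=> x; rewrite /L0_dev/= distrC.
Qed.

Let ball_triangle f g h e1 e2 :
  L0_ball f e1 g -> L0_ball g e2 h -> L0_ball f (e1 + e2) h.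
Proof.
rewrite /L0_ball/= => fg gh; rewrite EFinD.
apply: le_lt_trans (lteD fg gh); apply: le_trans (measureU2 _ _ _);
  [|exact: L0_measurable_dist..].
apply: le_measure; rewrite ?inE; [exact: L0_measurable_dist|
  by apply: measurableU; exact: L0_measurable_dist|].
move=> x; rewrite /L0_dev/= => le12; have [fgx|fgx] := leP e1 `|f x - g x|; [by left|right].
rewrite /= leNgt; apply/negP => ghx; move: le12; rewrite leNgt => /negP; apply.
rewrite -[f x - h x](subrKA (g x)).
by rewrite (le_lt_trans (ler_normD _ _))// ltrD.
Qed.

Let nbhs_L0 f : set_system (L0 mu) := nbhs_ (entourage_ L0_ball) f.

HB.instance Definition _ := hasNbhs.Build (L0 mu) nbhs_L0.

HB.instance Definition _ := Nbhs_isPseudoMetric.Build R (L0 mu)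
  erefl ball_center ball_sym ball_triangle erefl.

(* The Ky Fan metric induces convergence in measure. *)
Lemma L0_cvgP (F : set_system (L0 mu)) f : Filter F ->
  F --> f <-> forall e1 e2, 0 < e1 -> 0 < e2 ->
    \forall g \near F, (mu (L0_dev f g e1) < e2%:E)%E.
Proof.
move=> FF; split => [/cvg_ballP Ff e1 e2 e10 e20|Ff]; last first.
  by apply/cvg_ballP => e e0; exact: Ff.
have m0 : 0 < Num.min e1 e2 by rewrite lt_min e10.
apply: filterS (Ff _ m0) => g fg.
have m2 : ((Num.min e1 e2)%:E <= e2%:E)%E by rewrite lee_fin ge_min lexx orbT.
apply: le_lt_trans (lt_le_trans fg m2).
apply: le_measure; rewrite ?inE; [exact: L0_measurable_dist..|].
by move=> x; apply: le_trans; rewrite ge_min lexx.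
Qed.

End L0_topology.

Section L0_sub.
Context d (T : measurableType d) (R : realType) (mu : probability T R).
Implicit Types (f g h : L0 mu) (A : set (L0 mu)).

(* Ae-equal representatives have the same deviation sets up to null sets. *)
Lemma le_mu_dev f g f' g' e e' :
  {ae mu, forall x, e <= `|f x - g x| -> e' <= `|f' x - g' x|} ->
  (mu (L0_dev f g e) <= mu (L0_dev f' g' e'))%E.
Proof.
move=> [N [mN N0 dN]].
have : (mu (L0_dev f g e) <= mu (L0_dev f' g' e' `|` N))%E.
  apply: le_measure; rewrite ?inE.
  - exact: L0_measurable_dist.
  - by apply: measurableU => //; exact: L0_measurable_dist.
  move=> x ex; have [Nx|Nx] := pselect (N x); [by right|left].
  have /contrapT : ~ ~ (e <= `|f x - g x| -> e' <= `|f' x - g' x|).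
    by move=> /dN.
  exact.
move=> /le_trans; apply; apply: le_trans (measureU2 _ _ mN) _.
  exact: L0_measurable_dist.
by rewrite [X in (_ + X)%E](_ : _ = 0%E)// adde0.
Qed.

Definition L0_submod A :=
  A 0 /\ forall (a : R) f g, A f -> A g -> A (a *: f + g).

Lemma closure_submod A : L0_submod A -> L0_submod (closure A).
Proof.
move=> [A0 Alin]; split; first exact: subset_closure.
move=> a f g cf cg U /nbhs_ballP[e /= e0 eU].
pose e' := e / 2 / (1 + `|a|).
have a1 : 0 < 1 + `|a| by rewrite ltr_pwDl.
have e'0 : 0 < e' by rewrite !divr_gt0.
have [f' [Af' ff']] := cf _ (nbhsx_ballx f _ e'0).
have e20 : 0 < e / 2 by rewrite divr_gt0.
have [g' [Ag' gg']] := cg _ (nbhsx_ballx g _ e20).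
exists (a *: f' + g'); split; [exact: Alin|apply: eU].
rewrite [e]splitr; apply: (@ball_triangle _ _ (a *: f' + g)).
- rewrite /ball/= /L0_ball/=.
  apply: (@le_lt_trans _ _ (mu (L0_dev f f' e'))); last first.
    apply: lt_le_trans ff' _; rewrite lee_fin /e' ler_pdivrMr//.
    by rewrite ler_peMr ?lerDl// ltW.
  apply: le_mu_dev; near=> x.
  rewrite (near (L0_DE (a *: f) g) x)// (near (L0_ZE a f) x)//.
  rewrite (near (L0_DE (a *: f') g) x)// (near (L0_ZE a f') x)//.
  rewrite opprD addrACA subrr addr0 -mulrBr normrM => le2.
  rewrite /e' ler_pdivrMr// (le_trans le2)// mulrC ler_wpM2l//.
  by rewrite lerDr.
- rewrite /ball/= /L0_ball/=; apply: le_lt_trans gg'.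
  apply: le_mu_dev; near=> x.
  rewrite (near (L0_DE (a *: f') g) x)// (near (L0_DE (a *: f') g') x)//.
  by rewrite opprD addrACA subrr add0r.
Unshelve. all: by end_near. Qed.

End L0_sub.

(* A topological vector space is not declared as a pointed type, which the    *)
(* generated sigma-algebra requires; the base point plays no role.            *)
Definition pointed_tvs (R : realType) (X : tvsType R) : Type := X.
HB.instance Definition _ (R : realType) (X : tvsType R) :=
  Choice.on (pointed_tvs X).
HB.instance Definition _ (R : realType) (X : tvsType R) :=
  isPointed.Build (pointed_tvs X) 0.

Definition borel (R : realType) (X : tvsType R) :=
  g_sigma_algebraType (open : set (set (pointed_tvs X))).
HB.instance Definition _ (R : realType) (X : tvsType R) :=
  Measurable.on (borel X).

Section cgf.
Context (R : realType) (X : tvsType R) (mu : probability (borel X) R).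

Definition Kset : set (L0 mu) := [set T | exists phi : X -> R,
  [/\ scalar phi, continuous phi & {ae mu, forall x : borel X, T x = phi x}]].

Definition Mset : set (L0 mu) := closure Kset.

Definition cgf (T : L0 mu) : \bar R := lne (\int[mu]_x (expR (T x))%:E).

(* [set_type Mset] carries the topology induced by L0. *)
Definition lsc_minorant (f : set_type Mset -> \bar R) :=
  lower_semicontinuous f /\
  forall S : set_type Mset, Kset (set_val S) -> (f S <= cgf (set_val S))%E.

Definition Wbar (S : set_type Mset) : \bar R :=
  ereal_sup [set f S | f in lsc_minorant].

(* Wbar is the greatest lower semicontinuous function below cgf on Kset. *)
Lemma Wbar_greatest : lsc_minorant Wbar /\
  forall f, lsc_minorant f -> forall S, (f S <= Wbar S)%E.
Proof.
have ub f : lsc_minorant f -> forall S, (f S <= Wbar S)%E.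
  by move=> mf S; apply: ereal_sup_ubound; exists f.
split=> //; split=> [S a /ereal_sup_gt[_ [f mf <-]] aS|S KS].
  have [V SV aV] := mf.1 _ _ aS; exists V => // S' /aV aS'.
  exact: lt_le_trans aS' (ub _ mf _).
by apply: ge_ereal_sup => _ [f mf <-]; exact: mf.2.
Qed.

Definition Lset : set (L0 mu) :=
  Mset `&` [set T | mu.-integrable setT (EFin \o T)].

Lemma Kset_submod : L0_submod Kset.
Proof.
split.
  exists (cst 0); split; last exact: L0_0E.
  - by move=> a x y /=; rewrite mulr0 addr0.
  - exact: cst_continuous.
move=> a f g [phi [phil phic fE]] [psi [psil psic gE]].
exists (fun x => a * phi x + psi x); split.
- move=> b x y /=; rewrite phil psil /= !mulrDr addrACA.
  by congr (_ + _ + _); rewrite !mulrA (mulrC a).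
- move=> x; apply: (@continuousD R R X (fun x => a * phi x) psi x _ (psic x)).
  by apply: continuousM; [exact: cst_continuous|exact: phic].
- near=> x; rewrite (near (L0_DE (a *: f) g) x)// (near (L0_ZE a f) x)//.
  by rewrite (near fE x)// (near gE x).
Unshelve. all: by end_near. Qed.

Lemma Lset_submod : L0_submod Lset.
Proof.
have [M0 Mlin] := closure_submod Kset_submod.
have transfer (f : borel X -> R) (g : L0 mu) : mu.-integrable setT (EFin \o f) ->
    {ae mu, forall x, g x = f x} -> mu.-integrable setT (EFin \o g).
  move=> /integrableP[mf foo] gf; apply/integrableP; split.
    exact/measurable_EFinP/L0_measurable.
  rewrite (ae_eq_integral (abse \o (EFin \o f)))//.
  - exact/measurableT_comp/measurable_EFinP/L0_measurable.
  - exact: measurableT_comp.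
  - by apply: filterS gf => x /= ->.
split.
  split => //; apply: transfer (@L0_0E _ _ _ _).
  exact: integrable0.
move=> a f g [Mf If] [Mg Ig]; split; first exact: Mlin.
apply: (transfer (fun x => a * f x + g x)).
  exact: (integrableD measurableT (integrableZl measurableT a If) Ig).
near=> x; rewrite (near (L0_DE (a *: f) g) x)// (near (L0_ZE a f) x)//.
Unshelve. all: by end_near. Qed.

Definition Lpred : {pred L0 mu} := mem Lset.

Lemma Lpred_submod : submod_closed Lpred.
Proof.
have [L00 Llin] := Lset_submod.
split; first exact: mem_set.
by move=> a f g /set_mem Lf /set_mem Lg; apply/mem_set/Llin.
Qed.

HB.instance Definition _ :=
  GRing.isSubmodClosed.Build R (L0 mu) Lpred Lpred_submod.

Record Lmu := MkLmu { Lval : L0 mu ; Lval_in : Lval \in Lpred }.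

HB.instance Definition _ := [isSub for Lval].
HB.instance Definition _ := [Choice of Lmu by <:].
HB.instance Definition _ := [SubChoice_isSubLmodule of Lmu by <:].

Lemma LvalM (T : Lmu) : Lval T \in Mset.
Proof. by have /set_mem[MT _] := Lval_in T; exact: mem_set. Qed.

(* The restriction of Wbar to L(mu). *)
Definition W (T : Lmu) : \bar R := Wbar (exist _ (Lval T) (LvalM T)).

Definition asym_p (T : Lmu) : R := \int[mu]_x Num.max (- Lval T x) 0.

Definition asym_pbar (T : Lmu) : R := asym_p (- T).

Definition asym_dual (q : Lmu -> R) : set (Lmu -> R) :=
  [set z | scalar z /\ exists2 C : R, 0 <= C & forall T, z T <= C * q T].

Definition dual_cone : set (Lmu -> R) := asym_dual asym_pbar.

Definition norm_s (T : Lmu) : R := Num.max (asym_p T) (asym_pbar T).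

Definition dual_norm_s (z : Lmu -> R) : \bar R :=
  ereal_sup [set `|z T|%:E | T in [set T | norm_s T <= 1]].

Definition Wconj (y : Lmu -> R) : \bar R :=
  ereal_sup (range (fun T => (y T)%:E - W T)%E).

Definition is_minimiser (F : Lmu -> \bar R) (T : Lmu) :=
  F T = ereal_inf (range F).

Definition minimising (F : Lmu -> \bar R) (T_ : nat -> Lmu) :=
  F (T_ n) @[n --> \oo] --> ereal_inf (range F).

Definition pbar_weakly_cvg (T_ : nat -> Lmu) (T : Lmu) :=
  forall z, dual_cone z -> (limn_esup (fun n => (z (T_ n - T))%:E) <= 0)%E.

End cgf.

(* Main.v *)
From mathcomp Require Import lra.
Require Import Defs.
From HB Require Import structures.
From mathcomp Require Import all_boot all_order all_algebra.
From mathcomp Require Import all_classical all_reals all_analysis.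
From mathcomp Require Import measurable_realfun.

Set Implicit Arguments.
Unset Strict Implicit.
Unset Printing Implicit Defensive.

Import Order.TTheory GRing.Theory Num.Theory numFieldNormedType.Exports.

Local Open Scope classical_set_scope.
Local Open Scope ring_scope.

(** Put m = inf (W - y) and, for a level a, consider the tilted function
    exp ((T - a) / 2).  Two properties of W carry the proof.

    First, W T < a makes T an almost everywhere limit of elements of K with cgf
    below a ([W_lt_approx]), so that by Fatou's lemma bounds on K pass to W.
    Elements of K have mean zero; hence W T < a bounds by exp a both the
    integral of exp T and that of the negative part of T ([int_exp_le],
    [int_neg_le]).

    Second, W is uniformly convex in the Hellinger sense ([W_midpoint]): the
    squared L^2 distance between exp ((S - a) / 2) and exp ((T - b) / 2) is at
    most the convexity gap a + b - 2 W ((S + T) / 2) when W S < a and W T < b.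

    The bound on Wconj near y, tested against the functional that integrates
    over the set where T > 0, gives W T - y T >= delta * asym_pbar T - B
    ([W_growth]), so a minimising sequence has bounded levels.  Its tilted
    functions are Cauchy in L^2 by uniform convexity, and a subsequence of them
    converges almost everywhere.  The limit is positive because the negative
    parts of the T_n are bounded in L^1; so the T_n themselves converge almost
    everywhere along that subsequence, to some T in L(mu).  The exponential
    bound prevents the positive parts from losing mass, whence
    asym_pbar (T_n - T) tends to 0 ([asym_pbar_cvg0]).  Elements of the dual cone
    are controlled by asym_pbar, so limsup y (T_n) <= y T, and with the lower
    semicontinuity of W the function T is a minimiser
    ([near_minimisers_compact]).

    A minimiser need not be unique, because L(mu) may contain constants; but by
    uniform convexity two minimisers differ by a constant ([minimiser_tilt]),
    and the compactness argument shows that there is a largest one, T.  If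
    z (T_n - T) > e for infinitely many terms of a minimising sequence, those
    terms accumulate, in the above sense, at a minimiser T' <= T, and then
    z (T' - T) <= 0 is a contradiction. *)

(** * Sequences and inequalities of real numbers *)

Section elementary.
Context {R : realType}.
Implicit Types (s t a b r : R).

Lemma cvg_subseq (u : nat -> R) (l : R) (h : nat -> nat) :
  (forall n, (n <= h n)%N) -> u @ \oo --> l -> u (h n) @[n --> \oo] --> l.
Proof.
move=> nh ul; apply/cvgrPdist_lt => e e0; move/cvgrPdist_lt : ul => /(_ e e0)[N _ NP].
by exists N => // n /= Nn; apply: NP; exact: leq_trans (nh n).
Qed.

Lemma negpart_dist s t : `|Num.max (- s) 0 - Num.max (- t) 0| <= `|s - t|.
Proof.
have := ler_norm (s - t); have := ler_norm (- (s - t)); rewrite normrN => h1 h2.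
by rewrite ler_norml; case: (leP (- s) 0) => ?; case: (leP (- t) 0) => ?; apply/andP; split; lra.
Qed.

Lemma sqr_sub_add_prod s t : (s - t) ^+ 2 + 2 * (s * t) = s ^+ 2 + t ^+ 2.
Proof. lra. Qed.

Lemma expR_half_prod s t a b : expR ((s - a) / 2) * expR ((t - b) / 2) =
  expR (- ((a + b) / 2)) * expR (2^-1 * (s + t)).
Proof. by rewrite -!expRD; congr expR; lra. Qed.

(** With r the value at the midpoint, the left side bounds the squared
    Hellinger distance, and 1 - exp(-t) <= t makes the bound linear in the
    convexity gap. *)
Lemma convexity_gap_le a b r :
  2 - 2 * expR (- ((a + b) / 2)) * expR r <= a + b - 2 * r.
Proof.
by rewrite -mulrA -expRD; have := expR_ge1Dx (- ((a + b) / 2) + r); lra.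
Qed.

Lemma near_minimum_gap s t a b r :
  (s + r + a) + (t + r + b) - 2 * (2^-1 * (s + t) + r - (a + b) / 2) <= 2 * (a + b).
Proof. lra. Qed.

End elementary.

(** * Almost everywhere convergence on a probability space *)

Section convergence.
Context d (T : measurableType d) (R : realType) (mu : probability T R).

Lemma measurable_limn_einf (f_ : nat -> T -> R) :
  (forall n, measurable_fun setT (f_ n)) ->
  measurable_fun setT (fun x => limn_einf (fun n => (f_ n x)%:E)).
Proof.
move=> mf_; have -> : (fun x => limn_einf (fun n => (f_ n x)%:E)) =
    (fun x => - limn_esup (fun n => (- f_ n x)%:E))%E.
  by apply/funext => x; rewrite /limn_einf.
apply: measurableT_comp => //; apply: measurable_fun_limn_esup => n.
exact/measurable_EFinP/measurable_funN.
Qed.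

Lemma limn_einf_fin_ge0 (u : nat -> R) :
  (forall n, 0 <= u n) -> (0 <= limn_einf (fun n => (u n)%:E))%E.
Proof.
move=> u0; rewrite limn_einf_lim; apply: lime_ge; first exact: is_cvg_einfs.
by near=> n; apply: le_ereal_inf_tmp => _ [m _ <-]; rewrite lee_fin.
Unshelve. all: by end_near. Qed.

Lemma fatou_limn_einf (f_ : nat -> T -> R) (c : \bar R) :
  (forall n, measurable_fun setT (f_ n)) -> (forall n x, 0 <= f_ n x) ->
  (\forall n \near \oo, \int[mu]_x (f_ n x)%:E <= c)%E ->
  (\int[mu]_x limn_einf (fun n => (f_ n x)%:E) <= c)%E.
Proof.
move=> mf_ f_0 [N _ lec].
have mEf_ n : measurable_fun setT (EFin \o f_ n) by exact/measurable_EFinP.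
apply: le_trans (fatou mu measurableT mEf_ _) _ => [n x _|].
  by rewrite /= lee_fin.
rewrite limn_einf_lim; apply: lime_le; first exact: is_cvg_einfs.
near=> n; apply: ge_ereal_inf.
exists (\int[mu]_x (f_ (n + N)%N x)%:E)%E; last by apply: lec; rewrite /= leq_addl.
by exists (n + N)%N => //=; rewrite leq_addr.
Unshelve. all: by end_near. Qed.

(** Fatou's lemma in the form in which it transfers a bound on integrals from
    the terms of a sequence to its limit. *)
Lemma fatou_bound (f_ : nat -> T -> R) (f : T -> R) (c : \bar R) :
  (forall n, measurable_fun setT (f_ n)) -> measurable_fun setT f ->
  (forall n x, 0 <= f_ n x) -> (forall x, 0 <= f x) ->
  {ae mu, forall x, f_ n x @[n --> \oo] --> f x} ->
  (\forall n \near \oo, \int[mu]_x (f_ n x)%:E <= c)%E ->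
  (\int[mu]_x (f x)%:E <= c)%E.
Proof.
move=> mf_ mf f_0 f0 ff lec; apply: le_trans (fatou_limn_einf mf_ f_0 lec).
rewrite le_eqVlt; apply/orP; left; apply/eqP; apply: ge0_ae_eq_integral => //.
- exact/measurable_EFinP.
- exact: measurable_limn_einf.
- by move=> x _; rewrite lee_fin.
- by move=> x _; exact: limn_einf_fin_ge0.
- apply: filterS ff => x fx _.
  have fxE : (f_ n x)%:E @[n --> \oo] --> (f x)%:E.
    by apply: cvg_EFin => //; exact: nearW.
  by have [-> _] := cvg_limn_einf_sup fxE.
Qed.

(** An L^1 bound on a nonnegative sequence excludes that it tends to infinity
    on a set of positive measure. *)
Lemma ae_limn_einf_lty (f_ : nat -> T -> R) (c : R) :
  (forall n, measurable_fun setT (f_ n)) -> (forall n x, 0 <= f_ n x) ->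
  (forall n, \int[mu]_x (f_ n x)%:E <= c%:E)%E ->
  {ae mu, forall x, (limn_einf (fun n => (f_ n x)%:E) < +oo)%E}.
Proof.
move=> mf_ f_0 lec.
have mlim := measurable_limn_einf mf_.
have lim0 x : (0 <= limn_einf (fun n => (f_ n x)%:E))%E by exact: limn_einf_fin_ge0.
have ilim : mu.-integrable setT (fun x => limn_einf (fun n => (f_ n x)%:E)).
  apply/integrableP; split => //; under eq_integral do rewrite gee0_abs//.
  apply: le_lt_trans (fatou_limn_einf mf_ f_0 _) _; last exact: ltry c.
  exact: nearW.
by apply: filterS (integrable_ae measurableT ilim) => x /(_ I); rewrite ge0_fin_numE.
Qed.

(** Egorov's theorem: off a set of small measure the convergence is uniform. *)
Lemma ae_cvg_L0 (F : nat -> L0 mu) (f : L0 mu) :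
  {ae mu, forall x, F n x @[n --> \oo] --> f x} -> F @ \oo --> f.
Proof.
move=> Ff; apply/L0_cvgP => e1 e2 e10 e20.
have [|/=|B [mB Be2 uB]] := ae_pointwise_almost_uniform (mu := mu)
  (fun n => L0_measurable (F n)) (L0_measurable f) measurableT _ _ e20.
- by apply: (le_lt_trans (probability_le1 mu measurableT)); rewrite ltry.
- by apply: filterS Ff => x Fx _.
have /uB : nbhs (f : {uniform` setT `\` B -> R})
    [set h : T -> R | forall x, (setT `\` B) x -> ball (f x) e1 (h x)].
  apply/uniform_nbhs; exists [set xy | ball xy.1 e1 xy.2].
  by split => //; exact: (entourage_ball _ (PosNum e10)).
case=> N _ unif; exists N => // n Nn; apply: le_lt_trans Be2.
have Fn x : (setT `\` B) x -> ball (f x) e1 (F n x) by exact: unif.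
apply: le_measure; rewrite ?inE//; first exact: L0_measurable_dist.
move=> x; rewrite /L0_dev/= => e1x; apply: contrapT => Bx.
have := Fn x (conj I Bx); rewrite /ball/= distrC => e1x'.
by move: e1x; rewrite distrC leNgt e1x'.
Qed.

Lemma geometric_half_sum :
  (\sum_(0 <= n <oo) (2^-1 ^+ n : R)%:E = 2%:E)%E.
Proof.
rewrite (_ : 2%:E = (limn (series (geometric (1:R) 2^-1)))%:E).
  rewrite -EFin_lim; last first.
    by apply: is_cvg_geometric_series; rewrite ger0_norm// invf_lt1// ltr1n.
  congr (limn _); apply/funext => n /=; rewrite sumEFin.
  by rewrite /series/=; congr EFin; apply: eq_bigr => i _; rewrite mul1r.
congr EFin; apply/esym/cvg_lim => //.
rewrite [X in _ --> X](_ : 2 = 1 * (1 - 2^-1)^-1); last first.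
  by rewrite mul1r (_ : 1 - 2^-1 = 2^-1) ?invrK//; lra.
by apply: cvg_geometric_series; rewrite ger0_norm// invf_lt1// ltr1n.
Qed.

(** Borel-Cantelli: the exceptional sets have summable measures. *)
Lemma fast_ball_ae_cvg (F : nat -> L0 mu) (f : L0 mu) :
  (forall n, L0_ball f (2^-1 ^+ n) (F n)) ->
  {ae mu, forall x, F n x @[n --> \oo] --> f x}.
Proof.
move=> Ff; pose A n := L0_dev f (F n) (2^-1 ^+ n).
have A0 : mu (lim_sup_set A) = 0%E.
  apply: lim_sup_set_cvg0 => [k|]; first exact: L0_measurable_dist.
  apply: (@le_lt_trans _ _ (\sum_(0 <= n <oo) (2^-1 ^+ n)%:E)%E).
    by apply: lee_nneseries => n _ //; exact/ltW/Ff.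
  by rewrite geometric_half_sum ltry.
exists (lim_sup_set A); split => //.
  apply: bigcap_measurable => // k _; apply: bigcup_measurable => j _.
  exact: L0_measurable_dist.
move=> x /= Fx n _; apply: contrapT => nA; apply: Fx.
apply/cvgrPdist_lt => e e0.
have : (geometric (1:R) 2^-1) @ \oo --> 0.
  by apply: cvg_geometric; rewrite ger0_norm// invf_lt1// ltr1n.
move=> /cvgrPdist_lt/(_ e e0)[N _ NP]; exists (n + N)%N => // k /= nk.
have : ~ A k x by move=> Ak; apply: nA; exists k => //=; apply: leq_trans nk; exact: leq_addr.
rewrite /A /L0_dev/= => /negP; rewrite -ltNge => /lt_trans; apply.
have := NP k (leq_trans (leq_addl _ _) nk).
by rewrite /= mul1r sub0r normrN ger0_norm// exprn_ge0// invr_ge0.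
Qed.

(** The increments d_n satisfy |d_n| <= 2^-n + 2^n d_n^2, which bounds their L^1
    norms by 2 * 2^-n; hence their series converges absolutely almost
    everywhere. *)
Lemma fast_L2_ae_cauchy (u : nat -> T -> R) :
  (forall n, measurable_fun setT (u n)) ->
  (forall n, \int[mu]_x ((u n x - u n.+1 x) ^+ 2)%:E <= (4^-1 ^+ n)%:E)%E ->
  {ae mu, forall x, cvgn (u ^~ x)}.
Proof.
move=> mu_ u2; pose g n x : \bar R := (`|u n.+1 x - u n x|)%:E.
have md n : measurable_fun setT (fun x => u n.+1 x - u n x).
  exact: measurable_funB.
have mg n : measurable_fun setT (g n).
  exact/measurable_EFinP/measurableT_comp.
have g0 n x : (0 <= g n x)%E by rewrite lee_fin.
have g1 n : (\int[mu]_x g n x <= 2%:E * (2^-1 ^+ n)%:E)%E.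
  (* |d| <= s + d^2 / s, applied with s = 2^-n. *)
  have h0 : 0 <= 2^-1 ^+ n :> R by rewrite exprn_ge0// invr_ge0.
  have h1 : 2^-1 ^+ n * 2 ^+ n = 1 :> R by rewrite -exprMn mulVf ?expr1n.
  have h2 : 4^-1 ^+ n = 2^-1 ^+ n * 2^-1 ^+ n :> R.
    by rewrite -exprMn -invfM -natrM.
  have m2 : measurable_fun setT (fun x => (u n x - u n.+1 x) ^+ 2).
    by apply: measurable_funX; exact: measurable_funB.
  apply: (@le_trans _ _ (\int[mu]_x ((2^-1 ^+ n)%:E +
      (2 ^+ n)%:E * ((u n x - u n.+1 x) ^+ 2)%:E))%E).
    apply: ge0_le_integral => //.
    - apply: emeasurable_funD => //; apply: emeasurable_funM => //.
      exact/measurable_EFinP.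
    - move=> x _; rewrite -EFinM -EFinD lee_fin.
      set a := u n.+1 x; set b := u n x.
      rewrite (_ : (b - a) ^+ 2 = `|a - b| ^+ 2); last by rewrite real_normK ?num_real//; lra.
      have : 0 <= 2 ^+ n * (`|a - b| - 2^-1 ^+ n) ^+ 2.
        by rewrite mulr_ge0 ?sqr_ge0// exprn_ge0.
      have ab := normr_ge0 (a - b).
      move: h0 h1 ab; set s := 2^-1 ^+ n; set t := 2 ^+ n; set w := `|a - b|.
      move=> s0 st w0.
      have -> : t * (w - s) ^+ 2 = t * w ^+ 2 - 2 * (s * t) * w + (s * t) * s by lra.
      rewrite st; lra.
  rewrite ge0_integralD//; last 2 first.
  - by move=> x _; rewrite -EFinM lee_fin mulr_ge0// ?sqr_ge0// exprn_ge0.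
  - apply: emeasurable_funM => //; exact/measurable_EFinP.
  rewrite integral_cst// ge0_integralZl//; last 2 first.
  - exact/measurable_EFinP.
  - by move=> x _; rewrite lee_fin sqr_ge0.
  rewrite [X in (_ * X + _)%E](_ : _ = 1%E) ?mule1; last exact: probability_setT.
  apply: (@le_trans _ _ ((2^-1 ^+ n)%:E + (2 ^+ n)%:E * (4^-1 ^+ n)%:E)%E).
    by apply: leeD => //; apply: lee_wpmul2l => //; rewrite lee_fin exprn_ge0.
  rewrite -!EFinM -EFinD lee_fin h2 mulrA [2 ^+ n * _]mulrC h1; lra.
have sg : (\int[mu]_x (\sum_(0 <= n <oo) g n x) < +oo)%E.
  rewrite integral_nneseries//.
  apply: (@le_lt_trans _ _ (\sum_(0 <= n <oo) (2%:E * (2^-1 ^+ n)%:E))%E).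
    by apply: lee_nneseries => // n _ _; apply: integral_ge0 => x _; exact: g0.
  rewrite nneseriesZl; last by move=> n _; rewrite lee_fin exprn_ge0// invr_ge0.
  by rewrite geometric_half_sum -EFinM ltry.
have mS : measurable_fun setT (fun x => \sum_(0 <= n <oo) g n x)%E.
  by apply: (@ge0_emeasurable_sum _ _ _ setT g xpredT).
have iS : mu.-integrable setT (fun x => \sum_(0 <= n <oo) g n x)%E.
  apply/integrableP; split => //.
  under eq_integral do rewrite gee0_abs ?nneseries_ge0//.
  exact: sg.
apply: filterS (integrable_ae measurableT iS) => x /(_ I) Sx.
have cn : cvgn [normed series (fun n => u n.+1 x - u n x)].
  apply: nondecreasing_is_cvgn.
    by apply: nondecreasing_series => n _ _ /=.
  exists (fine (\sum_(0 <= n <oo) g n x)%E) => _ [n _ <-].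
  rewrite -lee_fin fineK//= seriesEnat/= -sumEFin.
  by apply: nneseries_lim_ge.
have := normed_cvg cn.
rewrite (_ : series _ = (fun n => u n x - u 0 x)); last first.
  by apply/funext => n; rewrite seriesEnat/= telescope_sumr.
move=> /cvg_ex[l ul]; apply/cvg_ex; exists (l + u 0 x).
rewrite (_ : u ^~ x = (fun n => (u n x - u 0 x) + u 0 x)).
  by apply: cvgD => //; exact: cvg_cst.
by apply/funext => n; rewrite subrK.
Qed.

(** The exponential bound makes the positive parts uniformly integrable, while
    nothing prevents the negative parts from losing mass; hence the one-sided
    conclusion.  Concretely, (F_n - f)^+ <= min ((F_n - f)^+, N + |f|) +
    exp (F_n - N): the first term is dominated and the second has integral at
    most A exp (-N). *)
Lemma positive_part_cvg0 (F : nat -> T -> R) (f : T -> R) (A : R) :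
  (forall n, measurable_fun setT (F n)) -> mu.-integrable setT (EFin \o f) ->
  {ae mu, forall x, F n x @[n --> \oo] --> f x} ->
  (forall n, \int[mu]_x (expR (F n x))%:E <= A%:E)%E ->
  (\int[mu]_x (Num.max (F n x - f x) 0)%:E)%E @[n --> \oo] --> 0%E.
Proof.
move=> mF intf Ff expF.
have mf : measurable_fun setT f by apply/measurable_EFinP/(measurable_int mu).
have mFf n : measurable_fun setT (fun x => F n x - f x) by exact: measurable_funB.
have mp n : measurable_fun setT (fun x => Num.max (F n x - f x) 0).
  exact: measurable_maxr.
have A0 : 0 <= A.
  rewrite -lee_fin; apply: le_trans (expF 0%N).
  by apply: integral_ge0 => x _; rewrite lee_fin expR_ge0.
have p0 n : (0 <= \int[mu]_x (Num.max (F n x - f x) 0)%:E)%E.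
  by apply: integral_ge0 => x _; rewrite lee_fin le_max lexx orbT.
pose h (N : R) n x : R := Num.min (Num.max (F n x - f x) 0) (N + `|f x|).
have h0 (N : R) n x : 0 <= N -> 0 <= h N n x.
  by move=> N0; rewrite /h le_min le_max lexx orbT/= addr_ge0.
have mh (N : R) n : measurable_fun setT (h N n).
  apply: measurable_minr => //; apply: measurable_funD => //.
  exact: measurableT_comp.
have hcvg (N : R) : 0 <= N -> (\int[mu]_x (h N n x)%:E)%E @[n --> \oo] --> 0%E.
  move=> N0.
  have [] := @dominated_convergence _ _ _ mu setT measurableT
    (fun n x => (h N n x)%:E) (cst 0%E) (fun x => (N + `|f x|)%:E).
  - by move=> n; exact/measurable_EFinP.
  - exact: measurable_cst.
  - apply: filterS Ff => x Fx _ /=; apply: cvg_EFin; first exact: nearW.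
    apply/cvgrPdist_lt => e e0; move/cvgrPdist_lt : Fx => /(_ e e0).
    apply: filterS => n; rewrite distrC; apply: le_lt_trans.
    rewrite sub0r normrN ger0_norm ?h0// /h ge_min ge_max normr_ge0 andbT.
    by rewrite ler_norm.
  - exact: (integrableD measurableT (finite_measure_integrable_cst mu N measurableT)
      (integrable_abse intf)).
  - apply: aeW => x n _; rewrite /= lee_fin ger0_norm ?h0// /h.
    by rewrite ge_min lexx orbT.
  - by move=> _ _; rewrite integral0.
have bound (N : R) n : 0 <= N -> (\int[mu]_x (Num.max (F n x - f x) 0)%:E <=
    \int[mu]_x (h N n x)%:E + (expR (- N) * A)%:E)%E.
  move=> N0.
  have mexp : measurable_fun setT (fun x => (expR (F n x))%:E).
    exact/measurable_EFinP/measurableT_comp.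
  have mhE : measurable_fun setT (fun x => (h N n x)%:E) by exact/measurable_EFinP.
  have e0 x : (0 <= (expR (F n x))%:E)%E by rewrite lee_fin expR_ge0.
  have mprod : measurable_fun setT (fun x => (expR (- N))%:E * (expR (F n x))%:E)%E.
    exact: emeasurable_funM.
  apply: (@le_trans _ _ (\int[mu]_x ((h N n x)%:E + (expR (- N))%:E * (expR (F n x))%:E))%E).
    apply: ge0_le_integral => //.
    - by move=> x _; rewrite lee_fin le_max lexx orbT.
    - exact/measurable_EFinP.
    - exact: emeasurable_funD.
    - move=> x _; rewrite -EFinM -EFinD lee_fin -expRD /h.
      have e1 := expR_ge1Dx (- N + F n x).
      have e2 := expR_ge0 (- N + F n x).
      have b1 : - f x <= `|f x| by rewrite -normrN ler_norm.
      have b0 := normr_ge0 (f x).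
      case: (leP (Num.max _ _) (N + _)) => _; first by lra.
      by rewrite ge_max; apply/andP; split; lra.
  rewrite ge0_integralD//; last by move=> x _; rewrite lee_fin h0.
  apply: leeD => //; rewrite ge0_integralZl//.
  by rewrite EFinM; apply: lee_wpmul2l => //; rewrite lee_fin expR_ge0.
have small (e : R) : 0 < e ->
    \forall n \near \oo, (\int[mu]_x (Num.max (F n x - f x) 0)%:E <= e%:E)%E.
  (* Since exp N >= 1 + N, this N gives A exp (-N) <= e / 2. *)
  move=> e0; pose N : R := 2 * A / e.
  have N0 : 0 <= N by rewrite /N divr_ge0// ?mulr_ge0// ltW.
  have NA : expR (- N) * A <= e / 2.
    rewrite expRN mulrC ler_pdivrMr ?expR_gt0//.
    have := expR_ge1Dx N; rewrite -(ler_pM2l (_ : 0 < e / 2)) ?divr_gt0//.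
    apply: le_trans.
    have -> : e / 2 * (1 + N) = e / 2 + A * (e * e^-1) by rewrite /N; lra.
    rewrite divff ?gt_eqF// mulr1; lra.
  have /fine_cvgP[hfin /cvgrPdist_lt/(_ (e / 2))] := hcvg N N0.
  rewrite divr_gt0// => /(_ isT) hsmall; near=> n.
  apply: le_trans (bound N n N0) _.
  have hn : (\int[mu]_x (h N n x)%:E)%E \is a fin_num by near: n.
  rewrite -(fineK hn) -EFinD lee_fin.
  have : `|0 - fine (\int[mu]_x (h N n x)%:E)%E| < e / 2 by near: n.
  rewrite sub0r normrN => /(le_lt_trans (ler_norm _)); lra.
have pfin : \forall n \near \oo, (\int[mu]_x (Num.max (F n x - f x) 0)%:E)%E \is a fin_num.
  by apply: filterS (small 1 ltr01) => n n1; rewrite ge0_fin_numE// (le_lt_trans n1)// ltry.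
apply/fine_cvgP; split => //; apply/cvgrPdist_le => e e0.
near=> n; rewrite /= sub0r normrN ger0_norm ?fine_ge0// -lee_fin fineK.
  by near: n; exact: small.
by near: n.
Unshelve. all: by end_near. Qed.

End convergence.

(** * Approximation and lower semicontinuity of W *)

Section cumulant.
Context (R : realType) (X : tvsType R) (mu : probability (borel X) R).
Implicit Types (S T : Lmu mu) (phi : L0 mu).

Lemma LvalD S T : {ae mu, forall x, Lval (S + T) x = Lval S x + Lval T x}.
Proof. exact: L0_DE. Qed.

Lemma LvalZ (a : R) T : {ae mu, forall x, Lval (a *: T) x = a * Lval T x}.
Proof. exact: L0_ZE. Qed.

Lemma LvalN T : {ae mu, forall x, Lval (- T) x = - Lval T x}.
Proof. exact: L0_NE. Qed.

Lemma LvalB S T : {ae mu, forall x, Lval (S - T) x = Lval S x - Lval T x}.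
Proof.
near=> x; rewrite (near (LvalD S (- T)) x)// (near (LvalN T) x)//.
Unshelve. all: by end_near. Qed.

Lemma Lval_measurable T : measurable_fun setT (Lval T).
Proof. exact: L0_measurable. Qed.

Lemma Lval_integrable T : mu.-integrable setT (EFin \o Lval T).
Proof. by have /set_mem[] := Lval_in T. Qed.

Lemma int_exp_ge0 phi : (0 <= \int[mu]_x (expR (phi x))%:E)%E.
Proof. by apply: integral_ge0 => x _; rewrite lee_fin expR_ge0. Qed.

Lemma cgf_lt_int_exp phi (a : R) : (cgf phi < a%:E)%E ->
  (\int[mu]_x (expR (phi x))%:E <= (expR a)%:E)%E.
Proof.
rewrite /cgf -lte_expeR lneK ?in_itv/= ?leey ?andbT; first exact: ltW.
exact: int_exp_ge0.
Qed.

Lemma lt_cgf_int_exp phi (r : R) : (r%:E < cgf phi)%E ->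
  ((expR r)%:E <= \int[mu]_x (expR (phi x))%:E)%E.
Proof.
rewrite /cgf -lte_expeR lneK ?in_itv/= ?leey ?andbT; first exact: ltW.
exact: int_exp_ge0.
Qed.

(** The lower limit of cgf along K is itself a lower semicontinuous function
    that is below cgf on K, so it lies below Wbar. *)
Lemma Wbar_lt_approx (S : set_type (@Mset R X mu)) (a e : R) :
  (Wbar S < a%:E)%E -> 0 < e ->
  exists phi, [/\ Kset phi, L0_ball (set_val S) e phi & (cgf phi < a%:E)%E].
Proof.
move=> WSa e0.
(* f is the lower limit of cgf along K. *)
pose near_inf (S' : set_type (@Mset R X mu)) (e' : R) : \bar R :=
  ereal_inf [set cgf phi | phi in [set phi | Kset phi /\ ball (set_val S') e' phi]].
pose f (S1 : set_type (@Mset R X mu)) := ereal_sup [set near_inf S1 e1 | e1 in [set e1 : R | 0 < e1]].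
have fmin : lsc_minorant f.
  split=> [S' b /ereal_sup_gt[_ [e' /= e'0 <-]] be'|S' KS'].
    exists (set_val @^-1` (ball (set_val S') (e' / 2))).
      apply: initial_continuous; apply: nbhsx_ballx; exact: divr_gt0.
    move=> S'' /= S'S''; apply: lt_le_trans be' _.
    apply: (@le_trans _ _ (near_inf S'' (e' / 2))); last first.
      by apply: ereal_sup_ubound; exists (e' / 2) => //=; exact: divr_gt0.
    apply: ereal_inf_le_tmp => _ [phi [Kphi S''phi] <-]; exists phi => //; split => //.
    by rewrite [e']splitr; exact: ball_triangle S'S'' S''phi.
  apply: ge_ereal_sup => _ [e' /= e'0 <-]; apply: ereal_inf_lbound.
  by exists (set_val S') => //; split => //; exact: ballxx.
have fSa : (f S < a%:E)%E := le_lt_trans ((Wbar_greatest mu).2 _ fmin S) WSa.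
have : (near_inf S e < a%:E)%E.
  by apply: le_lt_trans fSa; apply: ereal_sup_ubound; exists e.
by move=> /ereal_inf_lt[_ [phi [Kphi Sphi] <-] phia]; exists phi.
Qed.

Lemma W_lt_approx T (a : R) : (W T < a%:E)%E ->
  exists phi_ : nat -> L0 mu, [/\ forall n, Kset (phi_ n),
    forall n, (cgf (phi_ n) < a%:E)%E &
    {ae mu, forall x, phi_ n x @[n --> \oo] --> Lval T x}].
Proof.
move=> WTa.
have h n : {phi : L0 mu | [/\ Kset phi, L0_ball (Lval T) (2^-1 ^+ n) phi & (cgf phi < a%:E)%E]}.
  apply: cid; apply: (Wbar_lt_approx WTa).
  by rewrite exprn_gt0// invr_gt0.
exists (fun n => sval (h n)); split=> [n|n|]; [by case: (svalP (h n))..|].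
by apply: fast_ball_ae_cvg => n; case: (svalP (h n)).
Qed.

Lemma Wbar_lsc_seq (F : nat -> L0 mu) (f : L0 mu)
    (MF : forall n, F n \in @Mset R X mu) (Mf : f \in @Mset R X mu) (r : R) :
  {ae mu, forall x, F n x @[n --> \oo] --> f x} ->
  (r%:E < Wbar (exist _ f Mf))%E ->
  \forall n \near \oo, (r%:E < Wbar (exist _ (F n) (MF n)))%E.
Proof.
move=> /ae_cvg_L0 Ff; have [lscW _] := (Wbar_greatest mu).1.
move=> /lscW[V [/= B [[C oC CB] BS BV]] VP].
have : nbhs f C.
  apply: open_nbhs_nbhs; split => //.
  by move: BS; rewrite -CB.
move=> /Ff[N _ FN]; exists N => // n Nn; apply: VP; apply: BV.
by rewrite -CB; exact: FN.
Qed.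

Lemma Wbar_le_cgf (S : set_type (@Mset R X mu)) : Kset (set_val S) ->
  (Wbar S <= cgf (set_val S))%E.
Proof. exact: (Wbar_greatest mu).1.2. Qed.

End cumulant.

(** * Bounds on sublevel sets and uniform convexity of W *)

Section centred.
Context (R : realType) (X : tvsType R) (mu : probability (borel X) R).
Context (centred : forall phi : X -> R, scalar phi -> continuous phi ->
    mu.-integrable [set: borel X] (fun x => (phi x)%:E) /\
    (\int[mu]_x (phi x)%:E = 0%:E)%E).
Implicit Types (S T : Lmu mu) (phi psi : L0 mu).

Lemma Kset_centred phi : Kset phi ->
  mu.-integrable setT (EFin \o phi) /\ (\int[mu]_x (phi x)%:E = 0)%E.
Proof.
move=> [l [ll lc phil]]; have [il l0] := centred ll lc.
have ml : measurable_fun setT (fun x : borel X => (l x)%:E) := measurable_int _ il.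
have mphi : measurable_fun setT (EFin \o phi) by exact/measurable_EFinP/L0_measurable.
split; last first.
  by rewrite -[RHS]l0; apply: ae_eq_integral => //; apply: filterS phil => x /= -> _.
apply/integrableP; split=> //; move/integrableP : il => [_].
apply: le_lt_trans; apply: ae_ge0_le_integral => //.
- exact: measurableT_comp.
- exact: measurableT_comp.
- by apply: filterS phil => x /= -> _.
Qed.

(** This is the only way in which the vanishing of the means enters: pointwise
    lower bounds on exp phi - phi become lower bounds on the integral of
    exp phi. *)
Lemma int_exp_sub phi : Kset phi -> (\int[mu]_x (expR (phi x))%:E < +oo)%E ->
  (\int[mu]_x (expR (phi x) - phi x)%:E = \int[mu]_x (expR (phi x))%:E)%E.
Proof.
move=> /Kset_centred[iphi phi0] efin.
have ie : mu.-integrable setT (fun x => (expR (phi x))%:E).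
  apply/integrableP; split.
    exact/measurable_EFinP/measurableT_comp/L0_measurable.
  under eq_integral do rewrite gee0_abs ?lee_fin ?expR_ge0//.
  exact: efin.
have := integralB measurableT ie iphi.
by rewrite /comp/= phi0 sube0 => <-.
Qed.

Lemma cgf_ge0 phi : Kset phi -> (0 <= cgf phi)%E.
Proof.
move=> Kphi; rewrite /cgf lne_ge0.
have [->|efin] := eqVneq (\int[mu]_x (expR (phi x))%:E)%E +oo%E; first exact: leey.
rewrite -(int_exp_sub Kphi) ?ltey//.
have -> : 1%E = (\int[mu]_x (cst 1%E x))%E.
  by rewrite integral_cst// mul1e; apply/esym; exact: probability_setT.
apply: ge0_le_integral => //.
- apply/measurable_EFinP/measurable_funB; last exact: L0_measurable.
  exact/measurableT_comp/L0_measurable.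
- by move=> x _; rewrite lee_fin; have := expR_ge1Dx (phi x); lra.
Qed.

(** Follows from max (-t, 0) <= exp t - t. *)
Lemma int_neg_le_int_exp phi : Kset phi -> (\int[mu]_x (expR (phi x))%:E < +oo)%E ->
  (\int[mu]_x (Num.max (- phi x) 0)%:E <= \int[mu]_x (expR (phi x))%:E)%E.
Proof.
move=> Kphi /(int_exp_sub Kphi) <-; apply: ge0_le_integral => //.
- by move=> x _; rewrite lee_fin le_max lexx orbT.
- exact/measurable_EFinP/measurable_maxr/measurable_cst/measurable_funN/L0_measurable.
- apply/measurable_EFinP/measurable_funB; last exact: L0_measurable.
  exact/measurableT_comp/L0_measurable.
- move=> x _; rewrite lee_fin ge_max.
  by have := expR_ge1Dx (phi x); have := expR_ge0 (phi x); lra.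
Qed.

(** The constant 0 competes in the definition of Wbar, by Jensen's inequality
    on K. *)
Lemma W_ge0 T : (0 <= W T)%E.
Proof.
apply: ((Wbar_greatest mu).2 (cst 0%E)); split=> [S a a0|S KS]; last exact: cgf_ge0.
by exists setT => //; exact: filterT.
Qed.

Lemma int_exp_le T (a : R) : (W T < a%:E)%E ->
  (\int[mu]_x (expR (Lval T x))%:E <= (expR a)%:E)%E.
Proof.
move=> /W_lt_approx[phi_ [_ phia phiT]].
apply: (fatou_bound (f_ := fun n x => expR (phi_ n x))).
- by move=> n; exact/measurableT_comp/L0_measurable.
- exact/measurableT_comp/L0_measurable.
- by move=> n x; exact: expR_ge0.
- by move=> x; exact: expR_ge0.
- by apply: filterS phiT => x; apply: continuous_cvg; exact: continuous_expR.
- by apply: nearW => n; exact: cgf_lt_int_exp.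
Qed.

Lemma int_neg_le T (a : R) : (W T < a%:E)%E ->
  (\int[mu]_x (Num.max (- Lval T x) 0)%:E <= (expR a)%:E)%E.
Proof.
move=> /W_lt_approx[phi_ [Kphi phia phiT]].
have mneg phi : measurable_fun setT (fun x => Num.max (- phi x) 0).
  exact/measurable_maxr/measurable_cst/measurable_funN/L0_measurable.
apply: (fatou_bound (f_ := fun n x => Num.max (- phi_ n x) 0)) => //.
- by move=> n x; rewrite le_max lexx orbT.
- by move=> x; rewrite le_max lexx orbT.
- apply: filterS phiT => x phix.
  apply/cvgrPdist_lt => e e0; move/cvgrPdist_lt : phix => /(_ e e0).
  by apply: filterS => n; apply: le_lt_trans; exact: negpart_dist.
- apply: nearW => n; have ea := cgf_lt_int_exp (phia n).
  by apply: le_trans (ea); apply: int_neg_le_int_exp => //; apply: le_lt_trans ea _; rewrite ltry.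
Qed.

(** When a = cgf phi, this is the square root of the density of the exponentially
    tilted probability measure, so that L^2 distances between such functions
    are Hellinger distances. *)
Definition tilt (a : R) phi (x : borel X) : R := expR ((phi x - a) / 2).

Lemma measurable_tilt a phi : measurable_fun setT (tilt a phi).
Proof.
apply: measurableT_comp => //; apply: measurable_funM => //.
by apply: measurable_funB => //; exact: L0_measurable.
Qed.

Lemma int_tilt_sqr_le1 a phi : (cgf phi < a%:E)%E ->
  (\int[mu]_x (tilt a phi x ^+ 2)%:E <= 1)%E.
Proof.
move=> /cgf_lt_int_exp ea.
have E x : ((tilt a phi x ^+ 2)%:E = (expR (- a))%:E * (expR (phi x))%:E)%E.
  rewrite -EFinM -expRD expr2 -expRD; congr ((expR _)%:E); lra.
under eq_integral do rewrite E.
rewrite ge0_integralZl//; last first.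
  exact/measurable_EFinP/measurableT_comp/L0_measurable.
apply: (@le_trans _ _ ((expR (- a))%:E * (expR a)%:E)%E).
  by apply: lee_wpmul2l => //; rewrite lee_fin expR_ge0.
by rewrite -EFinM -expRD addNr expR0.
Qed.

(** Uniform convexity.  On K it comes from the identity u^2 + v^2 = (u - v)^2 + 2 u v
    for the tilted functions u and v, whose squares have integral at most 1 and
    whose product is, up to a constant, the exponential of the midpoint.
    Fatou's lemma and the lower semicontinuity of W pass it to the limit. *)
Lemma W_midpoint S T (a b r : R) : (W S < a%:E)%E -> (W T < b%:E)%E ->
  (r%:E < W (2^-1 *: (S + T)))%E ->
  (\int[mu]_x ((tilt a (Lval S) x - tilt b (Lval T) x) ^+ 2)%:E
     <= (a + b - 2 * r)%:E)%E.
Proof.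
move=> /W_lt_approx[phi_ [Kphi phia phiS]] /W_lt_approx[psi_ [Kpsi psib psiT]] rW.
pose mid n : L0 mu := 2^-1 *: (phi_ n + psi_ n).
have midE n : {ae mu, forall x, mid n x = 2^-1 * (phi_ n x + psi_ n x)}.
  near=> x; rewrite (near (L0_ZE 2^-1 (phi_ n + psi_ n)) x)//.
  by rewrite (near (L0_DE (phi_ n) (psi_ n)) x).
have Kmid n : Kset (mid n).
  have [K0 Klin] := @Kset_submod R X mu.
  rewrite /mid -[_ *: _]addr0; apply: (Klin) => //.
  by rewrite -[phi_ n]scale1r; exact: Klin.
have Mmid n : mid n \in @Mset R X mu by apply/mem_set/subset_closure.
have midcvg : {ae mu, forall x, mid n x @[n --> \oo] --> Lval (2^-1 *: (S + T)) x}.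
  have allmid : {ae mu, forall x n, mid n x = 2^-1 * (phi_ n x + psi_ n x)}.
    by apply/ae_foralln.
  near=> x; rewrite (near (LvalZ 2^-1 (S + T)) x)// (near (LvalD S T) x)//.
  have -> : (fun n => mid n x) = (fun n => 2^-1 * (phi_ n x + psi_ n x)).
    by apply/funext => n; rewrite (near allmid x).
  by apply: cvgMl_tmp; apply: cvgD; [exact: (near phiS x)|exact: (near psiT x)].
have lower : \forall n \near \oo, ((expR r)%:E <= \int[mu]_x (expR (mid n x))%:E)%E.
  have := Wbar_lsc_seq Mmid (Mf := LvalM _) midcvg rW.
  apply: filterS => n rn.
  by apply: lt_cgf_int_exp; apply: lt_le_trans rn (Wbar_le_cgf _); exact: Kmid.
apply: (fatou_bound (f_ := fun n x => (tilt a (phi_ n) x - tilt b (psi_ n) x) ^+ 2)).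
- by move=> n; apply: measurable_funX; apply: measurable_funB; exact: measurable_tilt.
- by apply: measurable_funX; apply: measurable_funB; exact: measurable_tilt.
- by move=> n x; exact: sqr_ge0.
- by move=> x; exact: sqr_ge0.
- near=> x.
  have tc (c : R) (u : nat -> R) (l : R) : u @ \oo --> l -> expR ((u n - c) / 2) @[n --> \oo] --> expR ((l - c) / 2).
    move=> ul; apply: continuous_cvg; first exact: continuous_expR.
    by apply: cvgMr_tmp; apply: cvgB => //; exact: cvg_cst.
  have phix : phi_ n x @[n --> \oo] --> Lval S x by near: x.
  have psix : psi_ n x @[n --> \oo] --> Lval T x by near: x.
  have dx : (tilt a (phi_ n) x - tilt b (psi_ n) x) @[n --> \oo] -->
      tilt a (Lval S) x - tilt b (Lval T) x.
    by apply: cvgB; exact: tc.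
  exact: (cvgM dx dx).
- apply: filterS lower => n ern.
  set u := tilt a (phi_ n); set v := tilt b (psi_ n).
  have u0 x : 0 <= u x by exact: expR_ge0.
  have v0 x : 0 <= v x by exact: expR_ge0.
  have mu_ : measurable_fun setT u by exact: measurable_tilt.
  have mv_ : measurable_fun setT v by exact: measurable_tilt.
  pose c : R := 2 * expR (- ((a + b) / 2)).
  have c0 : 0 <= c by rewrite mulr_ge0// expR_ge0.
  have memid : measurable_fun setT (fun x => (expR (mid n x))%:E).
    exact/measurable_EFinP/measurableT_comp/L0_measurable.
  have muv : measurable_fun setT (fun x => (2 * (u x * v x))%:E).
    by apply/measurable_EFinP/measurable_funM => //; exact: measurable_funM.
  have uvE : (\int[mu]_x (2 * (u x * v x))%:E = c%:E * \int[mu]_x (expR (mid n x))%:E)%E.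
    rewrite -ge0_integralZl//.
    apply: ge0_ae_eq_integral => //.
    - exact: emeasurable_funM.
    - by move=> x _; rewrite lee_fin !mulr_ge0.
    - by move=> x _; rewrite -EFinM lee_fin mulr_ge0// expR_ge0.
    - apply: filterS (midE n) => x mx _; rewrite /= -EFinM mx /c.
      by rewrite /u /v /tilt expR_half_prod mulrA.
  have m2 (w : borel X -> R) : measurable_fun setT w -> measurable_fun setT (fun x => (w x ^+ 2)%:E).
    by move=> mw; apply/measurable_EFinP/measurable_funX.
  have sum2 : (\int[mu]_x ((u x - v x) ^+ 2)%:E + \int[mu]_x (2 * (u x * v x))%:E <= 2)%E.
    rewrite -ge0_integralD//; last 3 first.
    - by move=> x _; rewrite lee_fin sqr_ge0.
    - by apply: m2; exact: measurable_funB.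
    - by move=> x _; rewrite lee_fin !mulr_ge0.
    rewrite (_ : (fun x => _) = (fun x => (u x ^+ 2)%:E + (v x ^+ 2)%:E)%E); last first.
      by apply/funext => x; rewrite -!EFinD sqr_sub_add_prod.
    rewrite ge0_integralD//; last 4 first.
    - by move=> x _; rewrite lee_fin sqr_ge0.
    - exact: m2.
    - by move=> x _; rewrite lee_fin sqr_ge0.
    - exact: m2.
    rewrite (_ : 2%E = 1 + 1)%E; last by rewrite -EFinD.
    by apply: leeD; exact: int_tilt_sqr_le1.
  have : (\int[mu]_x ((u x - v x) ^+ 2)%:E + (c * expR r)%:E <= 2)%E.
    apply: le_trans sum2; apply: leeD => //.
    by rewrite uvE EFinM; apply: lee_wpmul2l.
  rewrite -leeBrDr// => /le_trans; apply; rewrite -EFinB lee_fin /c.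
  exact: convexity_gap_le.
Unshelve. all: by end_near. Qed.

End centred.

(** * The asymmetric norms and the growth of W - y *)

Section asymmetric_norms.
Context (R : realType) (X : tvsType R) (mu : probability (borel X) R).
Implicit Types (S T : Lmu mu).

Lemma int_neg_fin_num T : (\int[mu]_x (Num.max (- Lval T x) 0)%:E)%E \is a fin_num.
Proof.
apply: integrable_fin_num => //.
exact: (integrable_funrneg measurableT (Lval_integrable T)).
Qed.

Lemma asym_pE T : (asym_p T)%:E = (\int[mu]_x (Num.max (- Lval T x) 0)%:E)%E.
Proof. by rewrite /asym_p /Rintegral fineK// int_neg_fin_num. Qed.

Lemma asym_pbarE T : (asym_pbar T)%:E = (\int[mu]_x (Num.max (Lval T x) 0)%:E)%E.
Proof.
rewrite /asym_pbar asym_pE; apply: ge0_ae_eq_integral => //.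
- exact/measurable_EFinP/measurable_maxr/measurable_cst/measurable_funN/L0_measurable.
- exact/measurable_EFinP/measurable_maxr/measurable_cst/L0_measurable.
- by move=> x _; rewrite lee_fin le_max lexx orbT.
- by move=> x _; rewrite lee_fin le_max lexx orbT.
- by apply: filterS (LvalN T) => x Tx _; rewrite Tx opprK.
Qed.

Lemma asym_pbar_eq0 T : {ae mu, forall x, Lval T x <= 0} -> asym_pbar T = 0.
Proof.
move=> T0; apply: EFin_inj; rewrite asym_pbarE -[RHS](integral0 mu setT).
apply: ge0_ae_eq_integral => //.
- exact/measurable_EFinP/measurable_maxr/measurable_cst/L0_measurable.
- by move=> x _; rewrite lee_fin le_max lexx orbT.
- by apply: filterS T0 => x Tx _; rewrite max_r.
Qed.

Section scalar_functionals.
Variables (z : Lmu mu -> R) (zlin : scalar z).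

Lemma scalar0 : z 0 = 0.
Proof. by have := zlin 1 0 0; rewrite scaler0 addr0 /=; lra. Qed.

Lemma scalarB S T : z (S - T) = z S - z T.
Proof. by have := zlin (-1) T S; rewrite scaleN1r (addrC (- T)) /= => ->; lra. Qed.

Lemma scalar_mid S T : z (2^-1 *: (S + T)) = 2^-1 * (z S + z T).
Proof.
have := zlin 1 S T; rewrite scale1r /= mul1r => <-.
by have := zlin 2^-1 (S + T) 0; rewrite !addr0 scalar0 /= addr0.
Qed.

End scalar_functionals.

Section positive_part_functional.
Variable T : Lmu mu.

Let P : set (borel X) := Lval T @^-1` `]0, +oo[.

Let mP : measurable P.
Proof. by rewrite -[P]setTI; apply: L0_measurable. Qed.

(** A functional of the dual cone that attains asym_pbar at T: it plays the part
    of a Hahn-Banach functional for the asymmetric norm. *)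
Definition pos_functional S : R := \int[mu]_x (\1_P x * Lval S x).

Let indicP01 x : \1_P x = 0 :> R \/ \1_P x = 1 :> R.
Proof. by rewrite indicE; case: (x \in P); [right|left]. Qed.

Let integrable_pos S : mu.-integrable setT (fun x => (\1_P x * Lval S x)%:E).
Proof.
apply: (le_integrable measurableT _ _ (Lval_integrable S)).
  apply/measurable_EFinP/measurable_funM; last exact: L0_measurable.
  exact: measurable_indic.
move=> x _; rewrite /= lee_fin.
by have [->|->] := indicP01 x; rewrite ?mul0r ?normr0 ?mul1r.
Qed.

Lemma pos_functionalE S :
  (pos_functional S)%:E = (\int[mu]_x (\1_P x * Lval S x)%:E)%E.
Proof. by rewrite /pos_functional /Rintegral fineK//; apply: integrable_fin_num. Qed.

Lemma pos_functional_scalar : scalar pos_functional.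
Proof.
move=> a S1 S2 /=; apply: EFin_inj; rewrite EFinD EFinM !pos_functionalE.
rewrite -integralZl// -integralD//; last exact: integrableZl.
apply: ae_eq_integral => //.
- exact: measurable_int (integrable_pos _).
- apply: emeasurable_funD; last exact: measurable_int (integrable_pos _).
  by apply: emeasurable_funM => //; exact: measurable_int (integrable_pos _).
- near=> x => _; rewrite (near (LvalD (a *: S1) S2) x)// (near (LvalZ a S1) x)//.
  by rewrite -EFinM -EFinD; congr EFin; lra.
Unshelve. all: by end_near. Qed.

Lemma pos_functional_le S : pos_functional S <= asym_pbar S.
Proof.
rewrite -lee_fin pos_functionalE asym_pbarE; apply: le_integral => //.
  exact: (integrable_funrpos measurableT (Lval_integrable S)).
move=> x _; rewrite lee_fin le_max.
by have [->|->] := indicP01 x; rewrite ?mul0r ?mul1r lexx ?orbT.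
Qed.

Lemma pos_functional_ge S : - asym_p S <= pos_functional S.
Proof.
rewrite lerNl -lee_fin EFinN pos_functionalE asym_pE -integralN//; last first.
  exact: integrable_add_def.
apply: le_integral => //.
- exact: integrableN.
- exact: (integrable_funrneg measurableT (Lval_integrable S)).
move=> x _; rewrite -EFinN lee_fin le_max.
by have [->|->] := indicP01 x; rewrite ?mul0r ?mul1r ?oppr0 lexx ?orbT.
Qed.

Lemma pos_functional_self : pos_functional T = asym_pbar T.
Proof.
apply: EFin_inj; rewrite pos_functionalE asym_pbarE; apply: eq_integral => x _.
congr EFin; rewrite indicE.
have [xP|xP] := boolP (x \in P).
  move: xP; rewrite inE /P/= in_itv/= andbT => T0.
  by rewrite mul1r max_l// ltW.
move: xP; rewrite notin_setE /P/= in_itv/= andbT => /negP; rewrite -leNgt => T0.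
by rewrite mul0r max_r.
Qed.

End positive_part_functional.

(** Wconj (y + z) <= B means W >= y + z - B; taking for z the functional
    eps / 2 * pos_functional T yields the term in asym_pbar T. *)
Lemma W_growth (y : Lmu mu -> R) :
  (exists2 eps : R, 0 < eps &
    (ereal_sup [set Wconj (y \+ z)%R | z in
       [set z | dual_cone z /\ (dual_norm_s z < eps%:E)%E]] < +oo)%E) ->
  exists delta B : R, 0 < delta /\
    forall T, ((delta * asym_pbar T + y T - B)%:E <= W T)%E.
Proof.
move=> [eps eps0 supfin].
have [B BP] : exists B : R, (ereal_sup [set Wconj (y \+ z)%R | z in
       [set z | dual_cone z /\ (dual_norm_s z < eps%:E)%E]] <= B%:E)%E.
  case: ereal_sup supfin => [r _|//|_]; first by exists r.
  by exists 0; rewrite leNye.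
have e20 : 0 < eps / 2 by rewrite divr_gt0.
exists (eps / 2), B; split=> // T.
pose z S := eps / 2 * pos_functional T S.
have zdual : dual_cone z.
  split=> [a S1 S2|].
    by rewrite /z pos_functional_scalar /=; lra.
  exists (eps / 2) => [|S]; first exact: ltW.
  by rewrite /z ler_pM2l// pos_functional_le.
have znorm : (dual_norm_s z < eps%:E)%E.
  apply: (@le_lt_trans _ _ (eps / 2)%:E); last by rewrite lte_fin; lra.
  apply: ge_ereal_sup => _ [S /= S1 <-]; rewrite lee_fin /z normrM gtr0_norm//.
  rewrite ger_pMr// ler_norml.
  move: S1; rewrite /norm_s ge_max => /andP[S1 S2].
  have := pos_functional_le T S; have := pos_functional_ge T S.
  by move=> ? ?; apply/andP; split; lra.
have : (((y \+ z) T)%:E - W T <= B%:E)%E.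
  apply: le_trans BP; apply: (@le_trans _ _ (Wconj (y \+ z)%R)).
    by apply: ereal_sup_ubound; exists T.
  by apply: ereal_sup_ubound; exists z.
rewrite /z/= pos_functional_self; case: (W T) => [w| |] //=.
- by rewrite -EFinB !lee_fin; lra.
- by rewrite leey.
Qed.

End asymmetric_norms.

(** * Almost everywhere limits of sequences with bounded W *)

Section compactness.
Context (R : realType) (X : tvsType R) (mu : probability (borel X) R).
Context (centred : forall phi : X -> R, scalar phi -> continuous phi ->
    mu.-integrable [set: borel X] (fun x => (phi x)%:E) /\
    (\int[mu]_x (phi x)%:E = 0%:E)%E).
Implicit Types (S T : Lmu mu).

(** The limit is integrable by Fatou's lemma, since |t| <= max (-t, 0) + exp t. *)
Lemma ae_limit_in_Lmu (S_ : nat -> Lmu mu) (A : R) :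
  (forall n, W (S_ n) < A%:E)%E ->
  {ae mu, forall x, cvgn (fun n => Lval (S_ n) x)} ->
  exists T, {ae mu, forall x, Lval (S_ n) x @[n --> \oo] --> Lval T x}.
Proof.
move=> WA cS.
pose t x : R := fine (limn_esup (fun n => (Lval (S_ n) x)%:E)).
have mt : measurable_fun setT t.
  apply: measurableT_comp => //; apply: measurable_fun_limn_esup => n.
  exact/measurable_EFinP/L0_measurable.
pose T0 : L0 mu := L0_class mu mt.
have ST : {ae mu, forall x, Lval (S_ n) x @[n --> \oo] --> T0 x}.
  near=> x; rewrite (near (L0_classE mu mt) x)// /t.
  have cx : cvgn (fun n => Lval (S_ n) x) by near: x.
  have cE : (Lval (S_ n) x)%:E @[n --> \oo] --> (limn (fun n => Lval (S_ n) x))%:E.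
    by apply: cvg_EFin => //; exact: nearW.
  by have [_ ->] := cvg_limn_einf_sup cE.
have MT : Mset T0.
  apply: (closed_cvg (@Mset R X mu) _ _ _ (ae_cvg_L0 ST)); first exact: closed_closure.
  by apply: nearW => n; have /set_mem[] := Lval_in (S_ n).
have iT : mu.-integrable setT (EFin \o T0).
  apply/integrableP; split; first exact/measurable_EFinP/L0_measurable.
  apply: (@le_lt_trans _ _ (expR A + expR A)%:E); last exact: ltry.
  apply: (fatou_bound (f_ := fun n x => `|Lval (S_ n) x|)).
  - by move=> n; exact/measurableT_comp/L0_measurable.
  - exact/measurableT_comp/L0_measurable.
  - by move=> n x; exact: normr_ge0.
  - by move=> x; exact: normr_ge0.
  - by apply: filterS ST => x; exact: cvg_norm.
  apply: nearW => n.
  have mneg : measurable_fun setT (fun x => (Num.max (- Lval (S_ n) x) 0)%:E).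
    exact/measurable_EFinP/measurable_maxr/measurable_cst/measurable_funN/L0_measurable.
  have mexp : measurable_fun setT (fun x => (expR (Lval (S_ n) x))%:E).
    exact/measurable_EFinP/measurableT_comp/L0_measurable.
  apply: (@le_trans _ _ (\int[mu]_x ((Num.max (- Lval (S_ n) x) 0)%:E + (expR (Lval (S_ n) x))%:E))%E).
    apply: ge0_le_integral => //.
    - exact/measurable_EFinP/measurableT_comp/L0_measurable.
    - exact: emeasurable_funD.
    - move=> x _; rewrite -EFinD lee_fin.
      have := expR_ge1Dx (Lval (S_ n) x); have := expR_ge0 (Lval (S_ n) x).
      case: (leP (- Lval (S_ n) x) 0) => h e0 e1; last by rewrite ltr0_norm; lra.
      by rewrite ger0_norm; lra.
  rewrite ge0_integralD//; last first.
    by move=> x _; rewrite lee_fin le_max lexx orbT.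
  by rewrite EFinD; apply: leeD; [exact: (int_neg_le centred)|exact: int_exp_le].
have LT : T0 \in @Lpred R X mu by apply/mem_set; split.
by exists (MkLmu LT).
Unshelve. all: by end_near. Qed.

(** Recovering u_n = c_n + 2 ln v_n from v_n = exp ((u_n - c_n) / 2) requires a
    positive limit of v_n.  If the limit were 0 then u_n would tend to -oo,
    against the bound on the lower limit of the negative parts. *)
Lemma tilt_cvg_pointwise (c : nat -> R) (u : nat -> R) (alpha A : R) :
  c @ \oo --> alpha -> (forall n, c n <= A) ->
  cvgn (fun n => expR ((u n - c n) / 2)) ->
  (limn_einf (fun n => (Num.max (- u n) 0)%:E) < +oo)%E -> cvgn u.
Proof.
move=> calpha cA cu.
set v := (fun n => expR ((u n - c n) / 2)) in cu *.
have vl : v @ \oo --> limn v := cu.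
move: vl; set l := limn v => vl neg.
have l0 : 0 <= l by apply: limr_ge cu _; apply: nearW => n; exact: expR_ge0.
have {l0} l0 : 0 < l.
  rewrite lt_neqAle l0 andbT; apply/eqP => l0E.
  suff : (Num.max (- u n) 0)%:E @[n --> \oo] --> +oo%E.
    by move=> /cvg_limn_einf_sup[ey _]; rewrite ey in neg.
  apply/cvgeyPge => K.
  have := cvgr_lt _ vl (expR ((- K - A) / 2)).
  rewrite -l0E expR_gt0 => /(_ _ isT); apply: filterS => n.
  rewrite ltr_expR => vn; have := cA n => cAn; rewrite lee_fin le_max.
  by apply/orP; left; lra.
have -> : u = (fun n => c n + 2 * ln (v n)).
  by apply/funext => n; rewrite /v expRK; lra.
apply/cvg_ex; exists (alpha + 2 * ln l); apply: cvgD => //.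
apply: cvgMl_tmp; apply: continuous_cvg => //; exact: continuous_ln.
Qed.

Lemma tilt_cauchy_limit (S_ : nat -> Lmu mu) (c : nat -> R) (alpha A : R) :
  c @ \oo --> alpha -> (forall n, c n <= A) -> (forall n, W (S_ n) < (c n)%:E)%E ->
  (forall n, \int[mu]_x ((tilt (c n) (Lval (S_ n)) x -
      tilt (c n.+1) (Lval (S_ n.+1)) x) ^+ 2)%:E <= (4^-1 ^+ n)%:E)%E ->
  exists T, {ae mu, forall x, Lval (S_ n) x @[n --> \oo] --> Lval T x}.
Proof.
move=> calpha cA Wc fast.
have WA n : (W (S_ n) < A%:E)%E by rewrite (lt_le_trans (Wc n))// lee_fin.
apply: (ae_limit_in_Lmu WA).
have cu := fast_L2_ae_cauchy (fun n => measurable_tilt (c n) (Lval (S_ n))) fast.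
have fin : {ae mu, forall x, (limn_einf (fun n => (Num.max (- Lval (S_ n) x) 0)%:E) < +oo)%E}.
  apply: (ae_limn_einf_lty (c := expR A)).
  - by move=> n; exact/measurable_maxr/measurable_cst/measurable_funN/L0_measurable.
  - by move=> n x; rewrite le_max lexx orbT.
  - by move=> n; exact: (int_neg_le centred).
near=> x; apply: (tilt_cvg_pointwise calpha cA); [by near: x|by near: x].
Unshelve. all: by end_near. Qed.

Lemma asym_pbar_cvg0 (S_ : nat -> Lmu mu) T (A : R) :
  (forall n, W (S_ n) < A%:E)%E ->
  {ae mu, forall x, Lval (S_ n) x @[n --> \oo] --> Lval T x} ->
  asym_pbar (S_ n - T) @[n --> \oo] --> 0.
Proof.
move=> WA ST.
have := positive_part_cvg0 (fun n => Lval_measurable (S_ n)) (Lval_integrable T) ST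
  (fun n => int_exp_le (WA n)).
move=> /fine_cvg; apply: cvg_trans; apply: near_eq_cvg; apply: nearW => n.
rewrite /= -[RHS]/(fine (asym_pbar (S_ n - T))%:E) asym_pbarE; congr fine.
apply: ge0_ae_eq_integral => //.
- exact/measurable_EFinP/measurable_maxr/measurable_cst/measurable_funB/L0_measurable/L0_measurable.
- exact/measurable_EFinP/measurable_maxr/measurable_cst/L0_measurable.
- by move=> x _; rewrite lee_fin le_max lexx orbT.
- by move=> x _; rewrite lee_fin le_max lexx orbT.
- by apply: filterS (LvalB (S_ n) T) => x -> _.
Qed.

Lemma W_le_lim (S_ : nat -> Lmu mu) T (c : nat -> R) (alpha : R) :
  {ae mu, forall x, Lval (S_ n) x @[n --> \oo] --> Lval T x} ->
  c @ \oo --> alpha -> (forall n, W (S_ n) < (c n)%:E)%E -> (W T <= alpha%:E)%E.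
Proof.
move=> ST calpha Wc; apply/lee_addgt0Pr => e e0; rewrite leNgt; apply/negP => aW.
have lsc := Wbar_lsc_seq (fun n => LvalM (S_ n)) ST aW.
have ca : \forall n \near \oo, c n < alpha + e by apply: cvgr_lt calpha _ _; rewrite ltrDl.
have [n [h1 h2]] := filter_ex (filterI lsc ca).
by have := lt_trans h1 (Wc n); rewrite lte_fin ltNge (ltW h2).
Qed.

End compactness.

(** * Compactness of near-minimisers *)

Section minimisers.
Context (R : realType) (X : tvsType R) (mu : probability (borel X) R).
Context (centred : forall phi : X -> R, scalar phi -> continuous phi ->
    mu.-integrable [set: borel X] (fun x => (phi x)%:E) /\
    (\int[mu]_x (phi x)%:E = 0%:E)%E).
Context (y : Lmu mu -> R) (y_dual : dual_cone y) (m : R)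
  (lower : forall T, ((y T + m)%:E <= W T)%E).
Implicit Types (S T : Lmu mu).

Lemma dual_cone_limsup (z : Lmu mu -> R) (S_ : nat -> Lmu mu) T (e : R) :
  dual_cone z -> asym_pbar (S_ n - T) @[n --> \oo] --> 0 -> 0 < e ->
  \forall n \near \oo, z (S_ n) < z T + e.
Proof.
move=> [zlin [C C0 zC]] pS e0.
have : C * asym_pbar (S_ n - T) @[n --> \oo] --> C * 0 by exact: cvgMl_tmp.
rewrite mulr0 => /cvgr_lt/(_ e e0); apply: filterS => n.
by have := zC (S_ n - T); rewrite (scalarB zlin); lra.
Qed.

(** The midpoint is worth at least m, so the convexity gap of two
    near-minimisers is at most the sum of their excesses; the factor 2 makes
    room for the strict inequality that [W_midpoint] asks of r. *)
Lemma near_minimisers_tilt S T (e e' : R) : 0 < e -> 0 < e' ->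
  (W S < (y S + m + e)%:E)%E -> (W T < (y T + m + e')%:E)%E ->
  (\int[mu]_x ((tilt (y S + m + e) (Lval S) x -
                tilt (y T + m + e') (Lval T) x) ^+ 2)%:E <= (2 * (e + e'))%:E)%E.
Proof.
move=> e0 e'0 WS WT.
pose r := y (2^-1 *: (S + T)) + m - (e + e') / 2.
have rW : (r%:E < W (2^-1 *: (S + T)))%E.
  by apply: lt_le_trans (lower _); rewrite lte_fin /r; lra.
apply: le_trans (W_midpoint WS WT rW) _.
by rewrite lee_fin /r (scalar_mid y_dual.1); exact: near_minimum_gap.
Qed.

(** At two exact minimisers the convexity gap vanishes, so their tilted
    functions coincide almost everywhere: the minimisers differ by a constant.
    In [De] the excess e is a free parameter, and changing it only multiplies
    the tilted functions by a constant. *)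
Lemma minimiser_tilt S T : W S = (y S + m)%:E -> W T = (y T + m)%:E ->
  {ae mu, forall x, Lval S x - y S = Lval T x - y T}.
Proof.
move=> WS WT.
pose D x := (tilt (y S + m) (Lval S) x - tilt (y T + m) (Lval T) x) ^+ 2.
have mD : measurable_fun setT D.
  by apply: measurable_funX; apply: measurable_funB; exact: measurable_tilt.
have De (e : R) : 0 < e -> e <= 1 -> (\int[mu]_x (D x)%:E <= (4 * expR 1 * e)%:E)%E.
  move=> e0 e1.
  have lt_add (U : Lmu mu) : W U = (y U + m)%:E -> (W U < (y U + m + e)%:E)%E.
    by move=> ->; rewrite lte_fin ltrDl.
  have h := near_minimisers_tilt e0 e0 (lt_add _ WS) (lt_add _ WT).
  have E x : D x = expR e * (tilt (y S + m + e) (Lval S) x - tilt (y T + m + e) (Lval T) x) ^+ 2.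
    have -> : expR e = expR (e / 2) ^+ 2 by rewrite expr2 -expRD; congr expR; lra.
    rewrite -exprMn mulrBr /tilt -!expRD /D /tilt.
    by congr ((expR _ - expR _) ^+ 2); lra.
  under eq_integral do rewrite E EFinM.
  rewrite ge0_integralZl//; last 2 first.
  - apply/measurable_EFinP/measurable_funX.
    by apply: measurable_funB; exact: measurable_tilt.
  - by move=> x _; rewrite lee_fin sqr_ge0.
  apply: (@le_trans _ _ ((expR e)%:E * (2 * (e + e))%:E)%E).
    by apply: lee_wpmul2l => //; rewrite lee_fin expR_ge0.
  rewrite -EFinM lee_fin; have le1 : expR e <= expR 1 by rewrite ler_expR.
  by have := ler_wpM2r (ltW e0) le1; lra.
have D0 : (\int[mu]_x (D x)%:E = 0)%E.
  apply/eqP; rewrite eq_le integral_ge0 ?andbT; last by move=> x _; rewrite lee_fin sqr_ge0.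
  apply/lee_addgt0Pr => e e0; rewrite add0e.
  pose e' := Num.min 1 (e / (4 * expR 1)).
  have c0 : 0 < 4 * expR 1 :> R by rewrite mulr_gt0// expR_gt0.
  apply: le_trans (De e' _ _) _.
  - by rewrite lt_min ltr01 divr_gt0.
  - by rewrite ge_min lexx.
  - by rewrite lee_fin mulrC -ler_pdivlMr// ge_min lexx orbT.
have mDE : measurable_fun setT (fun x => (D x)%:E) by exact/measurable_EFinP.
have [+ _] := ae_eq_integral_abs mu measurableT mDE.
under eq_integral do rewrite gee0_abs ?lee_fin ?sqr_ge0//.
move=> /(_ D0); apply: filterS => x /(_ I) /= [] /eqP.
rewrite sqrf_eq0 subr_eq0 => /eqP /expR_inj; lra.
Qed.

Context (growth : exists delta B : R, 0 < delta /\
    forall T, ((delta * asym_pbar T + y T - B)%:E <= W T)%E).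

Lemma near_minimisers_bounded : exists A : R, forall T,
  (W T < (y T + m + 1)%:E)%E -> y T + m + 1 <= A.
Proof.
have [delta [B [delta0 WB]]] := growth; have [ylin [C C0 yC]] := y_dual.
exists (C * ((m + 1 + B) / delta) + m + 1) => T WT.
have : delta * asym_pbar T + y T - B < y T + m + 1.
  by rewrite -lte_fin (le_lt_trans (WB T)).
move=> h; have : asym_pbar T <= (m + 1 + B) / delta.
  by rewrite ler_pdivlMr// mulrC; lra.
by move=> /(ler_wpM2l C0); have := yC T; lra.
Qed.

(** Two extractions are made: the first, by Bolzano-Weierstrass, makes the
    levels a_k converge; the second, n |-> 4^(n+1), makes the tilted functions
    Cauchy in L^2 at a geometric rate. *)
Lemma near_minimisers_compact (T_ : nat -> Lmu mu) :
  (forall k, W (T_ k) < (y (T_ k) + m + k.+1%:R^-1)%:E)%E ->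
  exists (f : nat -> nat) T, [/\ forall n, (n <= f n)%N, W T = (y T + m)%:E,
    asym_pbar (T_ (f n) - T) @[n --> \oo] --> 0 & y (T_ (f n)) @[n --> \oo] --> y T].
Proof.
move=> WT; pose a k := y (T_ k) + m + k.+1%:R^-1.
have [A AP] := near_minimisers_bounded.
have inv1 k : k.+1%:R^-1 <= 1 :> R by rewrite invf_le1 ?ltr0n// ler1n.
have aA k : a k <= A.
  apply: le_trans (AP (T_ k) _); first by rewrite /a lerD2l.
  by apply: lt_le_trans (WT k) _; rewrite lee_fin lerD2l.
have a0 k : 0 <= a k.
  by rewrite -lee_fin ltW// (le_lt_trans (W_ge0 centred (T_ k))).
have [g gincr /cvg_ex[alpha galpha]] : exists2 g : nat -> nat, increasing_seq g & cvgn (a \o g).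
  apply: bolzano_weierstrass; exists A; split; first exact: num_real.
  by move=> M AM k _ /=; rewrite ger0_norm// (le_trans (aA k))// ltW.
have gn n : (n <= g n)%N.
  elim: n => // n; rewrite -ltnS => /leq_trans; apply.
  by move/increasing_seqP : gincr; exact.
pose f n := g (4 ^ n.+1)%N.
have h4 n : (n <= 4 ^ n.+1)%N by rewrite ltnW// (leq_trans (ltn_expl n (isT : 1 < 4)%N))// leq_exp2l.
have fn n : (n <= f n)%N by rewrite (leq_trans (h4 n)).
have cf : a (f n) @[n --> \oo] --> alpha by exact: (cvg_subseq h4 galpha).
have finv n : (f n).+1%:R^-1 <= 4^-1 ^+ n.+1 :> R.
  rewrite exprVn lef_pV2 ?posrE ?ltr0n ?exprn_gt0//.
  by rewrite -natrX ler_nat (leq_trans (gn _)).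
have [T ST] : exists T, {ae mu, forall x, Lval (T_ (f n)) x @[n --> \oo] --> Lval T x}.
  apply: (tilt_cauchy_limit centred cf (fun n => aA (f n)) (fun n => WT (f n))) => n.
  apply: le_trans (near_minimisers_tilt _ _ (WT (f n)) (WT (f n.+1))) _ => //.
  rewrite lee_fin; have := finv n; have := finv n.+1; rewrite !exprS.
  have : 0 <= 4^-1 ^+ n :> R by rewrite exprn_ge0// invr_ge0.
  move: (4^-1 ^+ n) ((f n).+1%:R^-1) ((f n.+1).+1%:R^-1) => t i j; lra.
have WA n : (W (T_ (f n)) < (A + 1)%:E)%E.
  by apply: lt_trans (WT (f n)) _; rewrite lte_fin (le_lt_trans (aA (f n)))// ltrDl.
have pT := asym_pbar_cvg0 WA ST.
have Walpha : (W T <= alpha%:E)%E := W_le_lim ST cf (fun n => WT (f n)).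
have yf : y (T_ (f n)) @[n --> \oo] --> alpha - m.
  have -> : (fun n => y (T_ (f n))) = (fun n => a (f n) - m - (f n).+1%:R^-1).
    by apply/funext => n; rewrite /a; move: ((f n).+1%:R^-1) => i; lra.
  rewrite -[alpha - m]subr0; apply: cvgB; first by apply: cvgB => //; exact: cvg_cst.
  exact: (cvg_subseq fn (@cvg_harmonic R)).
have alphay : alpha - m <= y T.
  apply/ler_addgt0Pr => e e0; rewrite -(cvg_lim (@Rhausdorff R) yf).
  apply: limr_le; first exact: cvgP yf.
  by apply: filterS (dual_cone_limsup y_dual pT e0) => n /ltW.
have Ty : y T <= alpha - m.
  by have := le_trans (lower T) Walpha; rewrite lee_fin; lra.
have yT : alpha - m = y T by apply/eqP; rewrite eq_le alphay Ty.
exists f, T; split=> //; last by rewrite -yT.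
apply/eqP; rewrite eq_le lower andbT (le_trans Walpha)// lee_fin -yT; lra.
Qed.

End minimisers.

(** * Existence of a largest minimiser and convergence *)

Section infimum.
Context (R : realType) (X : tvsType R) (mu : probability (borel X) R).
Implicit Types (S T : Lmu mu).

Lemma W0_le : (W (0%R : Lmu mu) <= 0)%E.
Proof.
apply: le_trans (Wbar_le_cgf _) _; first exact: (Kset_submod mu).1.
rewrite /cgf (ge0_ae_eq_integral (g := cst 1%E))//.
- by rewrite integral_cst// mul1e [X in lne X](_ : _ = 1%E) ?lne1//; exact: probability_setT.
- exact/measurable_EFinP/measurableT_comp/L0_measurable.
- by apply: filterS (L0_0E mu) => x x0 _; rewrite x0 expR0.
Qed.

Lemma inf_fin_num (y : Lmu mu -> R) : scalar y -> (Wconj y < +oo)%E ->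
  ereal_inf (range (fun S => W S - (y S)%:E)%E) \is a fin_num.
Proof.
move=> ylin yfin.
have up : (ereal_inf (range (fun S => W S - (y S)%:E)%E) <= 0)%E.
  apply: ge_ereal_inf; exists (W (0%R : Lmu mu) - (y 0)%:E)%E; first by exists 0.
  by rewrite (scalar0 ylin) sube0 W0_le.
have [B yB] : exists B : R, (Wconj y <= B%:E)%E.
  case: (Wconj y) yfin => [r _|//|_]; first by exists r.
  by exists 0; rewrite leNye.
have low : ((- B)%:E <= ereal_inf (range (fun S => W S - (y S)%:E)%E))%E.
  apply: le_ereal_inf_tmp => _ [S _ <-].
  have : ((y S)%:E - W S <= B%:E)%E.
    by apply: le_trans yB; apply: ereal_sup_ubound; exists S.
  by case: (W S) => [w| |]//=; rewrite ?leey// -!EFinB !lee_fin; lra.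
by rewrite fin_numE; move: up low; case: ereal_inf.
Qed.

End infimum.

Theorem theorem5p3 (R : realType) (X : tvsType R) (mu : probability (borel X) R)
  (centred : forall phi : X -> R, scalar phi -> continuous phi ->
    mu.-integrable [set: borel X] (fun x => (phi x)%:E) /\
    (\int[mu]_x (phi x)%:E = 0%:E)%E)
  (y : Lmu mu -> R) (y_dual : dual_cone y)
  (y_dom : (Wconj y < +oo)%E)
  (y_bnd : exists2 eps : R, 0 < eps &
    (ereal_sup [set Wconj (y \+ z)%R | z in
       [set z | dual_cone z /\ (dual_norm_s z < eps%:E)%E]]
     < +oo)%E) :
  exists T : Lmu mu,
    is_minimiser (fun S => (W S - (y S)%:E)%E) T /\
    forall T_ : nat -> Lmu mu,
      minimising (fun S => (W S - (y S)%:E)%E) T_ -> pbar_weakly_cvg T_ T.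
Proof.
have ylin := y_dual.1.
have growth := W_growth y_bnd.
have inf_fin := inf_fin_num ylin y_dom.
rewrite /is_minimiser /minimising.
set I := ereal_inf _ in inf_fin *.
pose m := fine I; have IE : I = m%:E by rewrite fineK.
have lower (T : Lmu mu) : ((y T + m)%:E <= W T)%E.
  have : (m%:E <= W T - (y T)%:E)%E.
    by rewrite -IE; apply: ereal_inf_lbound; exists T.
  by rewrite leeBrDr// -EFinD addrC.
have inv0 k : 0 < k.+1%:R^-1 :> R by rewrite invr_gt0 ltr0n.
pose N := [set T : Lmu mu | W T = (y T + m)%:E].
have nearN (T : Lmu mu) (e : R) : N T -> 0 < e -> (W T < (y T + m + e)%:E)%E.
  by move=> -> e0; rewrite lte_fin ltrDl.
have compact := near_minimisers_compact centred y_dual lower growth.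
have [T0 NT0] : exists T0, N T0.
  have h k : {T : Lmu mu | (W T < (y T + m + k.+1%:R^-1)%:E)%E}.
    apply: cid; have : (I < (m + k.+1%:R^-1)%:E)%E by rewrite IE lte_fin ltrDl.
    move=> /ereal_inf_lt[_ [T _ <-]]; rewrite lteBlDr// -EFinD => WT.
    by exists T; rewrite -addrA addrC.
  have [f [T [_ WT _ _]]] := compact _ (fun k => svalP (h k)).
  by exists T.
(* Minimisers are ordered by their value of y, as they differ by constants. *)
have [T [NT Tmax]] : exists T, N T /\ forall S, N S -> y S <= y T.
  have [A AP] := near_minimisers_bounded y_dual m growth.
  have supN : has_sup (y @` N).
    split; first by exists (y T0), T0.
    exists (A - m - 1) => _ [S NS <-].
    by have := AP S (nearN S 1 NS ltr01); lra.
  have h k : {S : Lmu mu | N S /\ sup (y @` N) - k.+1%:R^-1 < y S}.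
    by apply: cid; have [_ [S NS <-] lt] := sup_adherent (inv0 k) supN; exists S.
  have [f [T [fn WT _ yT]]] := compact _ (fun k => nearN _ _ (svalP (h k)).1 (inv0 k)).
  exists T; split=> // S NS; apply: (@le_trans _ _ (sup (y @` N))).
    by apply: (ub_le_sup supN.2); exists S.
  apply: (ler_cvg_to (f := fun n => sup (y @` N) - (f n).+1%:R^-1) _ yT).
    rewrite -[X in _ --> X]subr0; apply: cvgB; first exact: cvg_cst.
    exact: (cvg_subseq fn (@cvg_harmonic R)).
  by apply: nearW => n; apply: ltW; have [] := svalP (h (f n)).
exists T; split; first by rewrite IE NT -EFinB; congr EFin; lra.
move=> T_; rewrite IE => Tmin z zdual; apply/lee_addgt0Pr => e e0; rewrite add0e.
suff : \forall n \near \oo, z (T_ n - T) <= e.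
  move=> ze; apply: ge_ereal_inf.
  exists (ereal_sup [set (z (T_ n - T))%:E | n in [set n | z (T_ n - T) <= e]]).
    by exists [set n | z (T_ n - T) <= e].
  by apply: ge_ereal_sup => _ [n /= zn <-]; rewrite lee_fin.
apply: contrapT => notnear.
(* Infinitely many terms are bad, so some bad term has excess below 1/(k+1). *)
have h k : {n | (W (T_ n) < (y (T_ n) + m + k.+1%:R^-1)%:E)%E /\ e < z (T_ n - T)}.
  have ev : \forall n \near \oo, (W (T_ n) - (y (T_ n))%:E < (m + k.+1%:R^-1)%:E)%E.
    have mlt : (m%:E < (m + k.+1%:R^-1)%:E)%E by rewrite lte_fin ltrDl.
    exact: (Tmin [set u | (u < (m + k.+1%:R^-1)%:E)%E] (open_ereal_lt' mlt)).
  apply: cid; apply: contrapT => noex; apply: notnear.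
  apply: filterS ev => n; rewrite lteBlDr// -EFinD => Wn.
  rewrite leNgt; apply/negP => zn; apply: noex; exists n; split=> //.
  by rewrite -addrA addrC.
have [f [T' [_ WT' pT' _]]] := compact _ (fun k => (svalP (h k)).1).
have T'T : asym_pbar (T' - T) = 0.
  apply: asym_pbar_eq0; near=> x.
  rewrite (near (LvalB T' T) x)//.
  have : Lval T' x - y T' = Lval T x - y T by near: x; exact: minimiser_tilt.
  by have := Tmax T' WT'; lra.
have zT' : z T' <= z T.
  have [C _ /(_ (T' - T))] := zdual.2.
  by rewrite T'T mulr0 (scalarB zdual.1); lra.
have [n zn] := filter_ex (dual_cone_limsup zdual pT' e0).
have := (svalP (h (f n))).2; rewrite (scalarB zdual.1); lra.
Unshelve. all: by end_near. Qed.
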